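(* Let $\alpha\in[1,\infty]$, let $v_0$ be front-like, and let $u$ be an advection of the form described in the context. Let $G^\epsilon_{\rm ptw}$ and $v^\epsilon_{\rm ptw}$ be the perturbed traveling waves defined in the context. Suppose that $v_0\ge v^\epsilon_{\rm ptw}(\cdot,\cdot,0)$ in $\mathbb R^n$ and that $v^\epsilon$ solves $$v^\epsilon_t+\epsilon\,u(x,y,\epsilon^\alpha t)\cdot Dv^\epsilon+\tfrac12|Dv^\epsilon|^2+\tfrac12=0\ \text{ in }\mathbb R^n\times\mathbb R_+,\qquad v^\epsilon=v_0\ \text{ on }\mathbb R^n\times\{0\}.$$ Then, for all $t\in\mathbb R_+$, $$\{(x,y):G^\epsilon_{\rm ptw}(x,y,t)\le0\}\subset\{(x,y):v^\epsilon(x,y,t)\le0\}\subset\{(x,y):v^\epsilon_{\rm ptw}(x,y,t)\le0\}.$$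
   Context: Notation. $n\ge2$; points of $\mathbb R^n$ are written $(x,y)$ with $x\in\mathbb R^{n-1}$, $y\in\mathbb R$. $\mathbb R_\pm=\{y\in\mathbb R:0<\pm y<\infty\}$. $D$ is the gradient in $(x,y)$. Convention: $\epsilon^\infty=0$. All functions may depend on $\omega$ in a probability space $(\Omega,\mathcal F,P)$ with expectation $E$; this dependence is suppressed. Solutions are viscosity solutions. Mild white noise. Let $\mathcal F_{y_1,y_2}=\sigma\{w(y):y_1\le y\le y_2\}$. A process $w:\mathbb R\times\Omega\to\mathbb R$ is mild white noise if (a) there is $M>0$ (taken $\ge1$) such that with probability one $\|w\|_{C^1(\mathbb R)}\le M$; (b) $E[w(y)]=0$ for all $y$; (c) $w$ is stationary and strongly mixing with rate $p>3/2$, i.e. $\int_0^\infty\varrho(y)^{1/p}dy<\infty$, where $\varrho(y)=\sup_{y_1}\sup_{y_2\ge y_1}\sup_{A\in\mathcal F_{y_2+y,\infty},\,B\in\mathcal F_{y_1,y_2}}\frac{|P(A\cap B)-P(A)P(B)|}{P(B)}$. It is normalized by $2\int_0^\infty E[w(0)w(\xi)]\,d\xi=1$. Advection. $u(x,y,t)=(u_\perp(x,y,t),\,u_\parallel(x,t)w(y))$ with $w$ mild white noise, $u_\perp\in C^2(\mathbb R^n\times\mathbb R_+)^{n-1}$ and $u_\parallel\in C^2(\mathbb R^{n-1}\times\mathbb R_+)$, bounded together with their derivatives up to order two and extended continuously to $t=0$. Throughout, $\epsilon>0$ is such that $\epsilon\|u\|_{C^1}\le1/100$. Front-like. A function $v_0\in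 L^\infty_{loc}(\mathbb R^n)$ is front-like if there exist $\underline G,\overline G\in C^{0,1}_{loc}(\mathbb R)\cap C^1_{loc}(\mathbb R_-\cup\mathbb R_+)$ with $\underline G',\overline G'>0$, $\underline G(y)\le v_0(x,y)\le\overline G(y)$ for all $(x,y)$, and $\underline G(0)=\overline G(0)=0$. Perturbed traveling waves. For $r\in\{1,2\}$ let $\rho^\epsilon_r$ be the unique globally Lipschitz solution of $r\epsilon\,u(x,y,0)\cdot D\rho^\epsilon_r+|D\rho^\epsilon_r|^r=1$ in $\mathbb R^n$, $\rho^\epsilon_r=0$ on $\mathbb R^{n-1}\times\{0\}$, such that, uniformly in $x\in\mathbb R^{n-1}$, $\liminf_{y\to\infty}\rho^\epsilon_r(x,y)\ge0$ and $\limsup_{y\to-\infty}\rho^\epsilon_r(x,y)\le0$. Then $G^\epsilon_{\rm ptw}$ is the solution of $G_t+\epsilon\,u(x,y,\epsilon^\alpha t)\cdot DG+|DG|=0$ in $\mathbb R^n\times\mathbb R_+$ with $G(\cdot,\cdot,0)=\rho^\epsilon_1$, and $v^\epsilon_{\rm ptw}$ is the solution of $v_t+\epsilon\,u(x,y,\epsilon^\alpha t)\cdot Dv+\frac12|Dv|^2+\frac12=0$ in $\mathbb R^n\times\mathbb R_+$ with $v(\cdot,\cdot,0)=\rho^\epsilon_2$. *)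

(* Defs.v *)
From HB Require Import structures.
From mathcomp Require Import all_boot all_order all_algebra.
From mathcomp Require Import all_classical all_reals all_analysis.

Set Implicit Arguments.
Unset Strict Implicit.
Unset Printing Implicit Defensive.

Import Order.TTheory GRing.Theory Num.Theory.
Import numFieldNormedType.Exports.

Local Open Scope classical_set_scope.
Local Open Scope ring_scope.

(* R^n as pairs (x, y) with x in R^(n-1), and space-time points ((x, y), t).
   Functions on space-time are total; only their values for t >= 0 matter. *)
Definition euclid (R : realType) (n : nat) : Type := ('rV[R]_n.-1 * R)%type.

Definition upper (R : realType) (V : Type) : set (V * R) := [set z | 0 < z.2].
Definition upper_closed (R : realType) (V : Type) : set (V * R) :=
  [set z | 0 <= z.2].

Section Smooth.
Context {R : realType}.
Implicit Types V W : normedModType R.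

(* For U open and V of finite dimension, this is C^k(U; W). *)
Fixpoint Ck V W (k : nat) (U : set V) (f : V -> W) : Prop :=
  match k with
  | 0%N => forall z, U z -> {for z, continuous f}
  | k'.+1 => (forall z, U z -> differentiable f z) /\
             (forall v, Ck k' U (fun z => 'D_v f z))
  end.

Fixpoint Ck_bounded V W (k : nat) (U : set V) (f : V -> W) : Prop :=
  (exists C, forall z, U z -> `|f z| <= C) /\
  match k with
  | 0%N => True
  | k'.+1 => forall v, Ck_bounded k' U (fun z => 'D_v f z)
  end.

(* max (sup |f|, sup |Df|), with |Df| the operator norm; the norms nV and nW
   are explicit because the library's norm on products and matrices is the
   sup norm rather than the Euclidean one. *)
Definition C1norm V W (nV : V -> R) (nW : W -> R) (U : set V) (f : V -> W) :
    \bar R :=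
  maxe (ereal_sup [set (nW (f z))%:E | z in U])
       (ereal_sup [set (nW ('D_p.2 f p.1))%:E
                  | p in [set p : V * V | U p.1 /\ nV p.2 = 1]]).

(* Continuous viscosity solutions of A v = 0 in the open set U, where A is a
   first-order differential operator: A phi z depends on phi only through
   phi z and the first derivatives of phi at z. *)
Definition viscosity_subsolution V (U : set V) (A : (V -> R) -> V -> R)
    (v : V -> R) : Prop :=
  (forall z, U z -> {for z, continuous v}) /\
  forall (phi : V -> R) (z : V), U z -> Ck 1%N U phi ->
    (\forall z' \near z, v z' - phi z' <= v z - phi z) -> A phi z <= 0.

Definition viscosity_supersolution V (U : set V) (A : (V -> R) -> V -> R)
    (v : V -> R) : Prop :=
  (forall z, U z -> {for z, continuous v}) /\
  forall (phi : V -> R) (z : V), U z -> Ck 1%N U phi ->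
    (\forall z' \near z, v z - phi z <= v z' - phi z') -> 0 <= A phi z.

Definition viscosity_solution V (U : set V) (A : (V -> R) -> V -> R)
    (v : V -> R) : Prop :=
  viscosity_subsolution U A v /\ viscosity_supersolution U A v.

End Smooth.

Section Space.
Context {R : realType} {n : nat}.
Local Notation X := (euclid R n).

Definition dot (p q : X) : R :=
  \sum_(i < n.-1) p.1 ord0 i * q.1 ord0 i + p.2 * q.2.

Definition enorm (p : X) : R := Num.sqrt (dot p p).

Definition enorm_st (p : X * R) : R := Num.sqrt (dot p.1 p.1 + p.2 ^+ 2).

Definition grad (f : X -> R) (z : X) : X :=
  (\row_i 'D_(delta_mx ord0 i, 0) f z, 'D_(0, 1) f z).

Definition evolution (H : X * R -> X -> R) (phi : X * R -> R) (z : X * R) : R :=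
  derive1 (fun s => phi (z.1, s)) z.2 + H z (grad (fun x => phi (x, z.2)) z.1).

(* v_t + H(z, t, Dv) = 0 in R^n x R_+ with v = v0 at time 0. Since v0 may be
   discontinuous, the initial datum is attained in the sense of semicontinuous
   envelopes: v^*(., 0) <= v0^* and v_*(., 0) >= (v0)_*. For continuous v0 this
   says exactly that v is continuous up to time 0. *)
Definition solves_IVP (H : X * R -> X -> R) (v0 : X -> R) (v : X * R -> R) :
    Prop :=
  [/\ viscosity_solution (@upper R X) (evolution H) v,
      forall x, v (x, 0) = v0 x,
      forall x, (limf_esup (EFin \o v)
                   (within (@upper_closed R X) (nbhs ((x, 0%R) : X * R)))
                 <= limf_esup (EFin \o v0) (nbhs x))%E &
      forall x, (limf_einf (EFin \o v0) (nbhs x)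
                 <= limf_einf (EFin \o v)
                   (within (@upper_closed R X) (nbhs ((x, 0%R) : X * R))))%E].

Definition box (a b : X) : set X :=
  [set z : X | (forall i, a.1 ord0 i <= z.1 ord0 i <= b.1 ord0 i) /\
           a.2 <= z.2 <= b.2].

Definition box_volume (a b : X) : R :=
  (\prod_(i < n.-1) (b.1 ord0 i - a.1 ord0 i)) * (b.2 - a.2).

Definition lebesgue_null (A : set X) : Prop :=
  forall e : R, 0 < e -> exists a b : nat -> X,
    [/\ forall k, box (a k) (b k) !=set0,
        A `<=` \bigcup_k box (a k) (b k) &
        forall N, \sum_(k < N) box_volume (a k) (b k) <= e].

Definition lebesgue_measurable_fun (f : X -> R) : Prop :=
  exists2 g : X -> R, lebesgue_null [set z | f z != g z] &
    forall O : set R, open O -> <<s [set B : set X | open B] >> (g @^-1` O).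

Definition Linfty_loc (f : X -> R) : Prop :=
  lebesgue_measurable_fun f /\
  forall z : X, exists C : R, exists2 B : set X, nbhs z B &
    lebesgue_null [set z' | B z' /\ C < `|f z'|].

Definition front_bound (G : R -> R) : Prop :=
  [/\ forall y : R, exists2 B : set R, nbhs y B & [lipschitz G z | z in B],
      Ck 1%N [set y : R | y != 0] G,
      forall y : R, y != 0 -> 0 < derive1 G y &
      G 0 = 0].

Definition front_like (v0 : X -> R) : Prop :=
  Linfty_loc v0 /\
  exists Gl Gu : R -> R,
    [/\ front_bound Gl, front_bound Gu &
        forall z : X, Gl z.2 <= v0 z <= Gu z.2].

End Space.

Section WhiteNoise.
Context {R : realType} {d : measure_display} {Omega : measurableType d}.
Variable P : probability Omega R.
Variable w : R -> {RV P >-> R}.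

(* F_(y1, y2), with y2 possibly +oo. *)
Definition noise_algebra (y1 : R) (y2 : \bar R) : set (set Omega) :=
  <<s [set A | exists y, [/\ y1 <= y, (y%:E <= y2)%E &
                exists2 B : set R, measurable B & A = w y @^-1` B]] >>.

(* The events B with P(B) = 0, for which the quotient is 0/0, are discarded. *)
Definition mixing_rate (y : R) : \bar R :=
  ereal_sup [set r : \bar R | exists y1 y2 A B,
    [/\ y1 <= y2, noise_algebra (y2 + y) +oo%E A, noise_algebra y1 y2%:E B,
        (0 < P B)%E &
        r = (`|fine (P (A `&` B)) - fine (P A) * fine (P B)|
               / fine (P B))%:E]].

Definition stationary : Prop :=
  forall (k : nat) (y : 'I_k -> R) (B : 'I_k -> set R) (h : R),
    (forall i, measurable (B i)) ->
    P [set o | forall i, B i (w (y i) o)] =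
    P [set o | forall i, B i (w (y i + h) o)].

Definition mild_white_noise : Prop :=
  [/\ exists2 M : R, 1 <= M &
        {ae P, forall o, Ck 1%N setT (fun y : R => w y o) /\
           (C1norm Num.norm Num.norm setT (fun y : R => w y o : R) <= M%:E)%E},
      forall y, ('E_P[w y] = 0)%E,
      stationary,
      exists2 p : R, 3%:R / 2%:R < p &
        (\int[lebesgue_measure]_(y in `[0%R, +oo[%classic)
           (mixing_rate y `^ p^-1) < +oo)%E &
      (2%:E * \int[lebesgue_measure]_(y in `[0%R, +oo[%classic)
         'E_P[(fun o => w 0 o * w y o)%R] = 1)%E].

End WhiteNoise.

Section Fronts.
Context {R : realType} {n : nat}.
Local Notation X := (euclid R n).

Definition advection (uperp : X * R -> 'rV[R]_n.-1)
    (upar : 'rV[R]_n.-1 * R -> R) (w : R -> R) (z : X * R) : X :=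
  (uperp z, upar (z.1.1, z.2) * w z.1.2).

Definition C2_bounded_upto0 (V W : normedModType R) (f : V * R -> W) : Prop :=
  [/\ Ck 2%N (@upper R V) f, Ck_bounded 2%N (@upper R V) f &
      {within (@upper_closed R V), continuous f}].

(* eps^alpha, with the convention eps^oo = 0 (alpha = -oo is not used). *)
Definition eps_power (eps : R) (alpha : \bar R) : R :=
  match alpha with a%:E => eps `^ a | _ => 0 end.

Definition H_G (eps : R) (alpha : \bar R) (u : X * R -> X)
    (z : X * R) (p : X) : R :=
  eps * dot (u (z.1, eps_power eps alpha * z.2)) p + enorm p.

Definition H_v (eps : R) (alpha : \bar R) (u : X * R -> X)
    (z : X * R) (p : X) : R :=
  eps * dot (u (z.1, eps_power eps alpha * z.2)) p
    + 2%:R^-1 * enorm p ^+ 2 + 2%:R^-1.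

Definition ptw_profile (r : nat) (eps : R) (u : X * R -> X) (rho : X -> R) :
    Prop :=
  [/\ lipschitz rho,
      viscosity_solution setT
        (fun phi z => r%:R * eps * dot (u (z, 0)) (grad phi z)
                        + enorm (grad phi z) ^+ r - 1) rho,
      forall x, rho (x, 0) = 0,
      forall e : R, 0 < e -> \forall y \near +oo%R, forall x, - e <= rho (x, y) &
      forall e : R, 0 < e -> \forall y \near -oo%R, forall x, rho (x, y) <= e].

Definition is_G_ptw (eps : R) (alpha : \bar R) (u : X * R -> X)
    (G : X * R -> R) : Prop :=
  exists2 rho, ptw_profile 1%N eps u rho & solves_IVP (H_G eps alpha u) rho G.

Definition is_v_ptw (eps : R) (alpha : \bar R) (u : X * R -> X)
    (v : X * R -> R) : Prop :=
  exists2 rho, ptw_profile 2%N eps u rho & solves_IVP (H_v eps alpha u) rho v.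

End Fronts.

(* Main.v *)
Require Import Defs.
From HB Require Import structures.
From mathcomp Require Import all_boot all_order all_algebra.
From mathcomp Require Import all_classical all_reals all_analysis.
From mathcomp Require Import ring lra.

Set Implicit Arguments.
Unset Strict Implicit.
Unset Printing Implicit Defensive.

Import Order.TTheory GRing.Theory Num.Theory.
Import numFieldNormedType.Exports.

Local Open Scope classical_set_scope.
Local Open Scope ring_scope.

(** The drift is bounded by 1/100 and Lipschitz. For the comparison
v_ptw <= v, no growth is assumed at infinity; it is recovered from the equation,
whose subsolutions satisfy f(x1, t) <= f(x0, s) + |x1 - x0|^2 / (t - s). Applied
up to a distant time this bounds v from below by a quadratic with a small
coefficient, so lam v_ptw - v stays below (1 - lam) times a fixed quadratic
barrier, by convexity of the Hamiltonian and doubling of variables; then lam -> 1.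

Since |p| <= (|p|^2 + 1) / 2, v is also a subsolution of the G-equation. This
equation being geometric, eta e^(K G) is a supersolution, and on a given ball it
dominates the initial data once K is large, because the profile of G is at least
min(1, y^2 / 5) for y > 0. Finite speed of propagation then gives v <= eta
wherever G <= 0. *)

Section EuclideanStructure.
Context {R : realType} {n : nat}.
Local Notation X := (euclid R n).
Implicit Types (p q r : X) (c : R).

Lemma dotC p q : dot p q = dot q p.
Proof. by rewrite /dot mulrC; congr (_ + _); apply: eq_bigr => i _; rewrite mulrC. Qed.

Lemma dotDl p q r : dot (p + q) r = dot p r + dot q r.
Proof.
rewrite /dot /= mulrDl addrACA -big_split/=; congr (_ + _).
by apply: eq_bigr => i _; rewrite !mxE mulrDl.
Qed.

Lemma dotZl c p q : dot (c *: p) q = c * dot p q.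
Proof.
rewrite /dot /= mulrDr mulr_sumr mulrA; congr (_ + _).
by apply: eq_bigr => i _; rewrite !mxE mulrA.
Qed.

Lemma dotNl p q : dot (- p) q = - dot p q.
Proof. by rewrite -scaleN1r dotZl mulN1r. Qed.

Lemma dotBl p q r : dot (p - q) r = dot p r - dot q r.
Proof. by rewrite dotDl dotNl. Qed.

Lemma dotDr p q r : dot r (p + q) = dot r p + dot r q.
Proof. by rewrite dotC dotDl !(dotC r). Qed.

Lemma dotZr c p q : dot q (c *: p) = c * dot q p.
Proof. by rewrite dotC dotZl dotC. Qed.

Lemma dotNr p q : dot q (- p) = - dot q p.
Proof. by rewrite dotC dotNl dotC. Qed.

Lemma dotBr p q r : dot r (p - q) = dot r p - dot r q.
Proof. by rewrite dotDr dotNr. Qed.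

Lemma dot0l p : dot 0 p = 0.
Proof. by rewrite -(scale0r (0 : X)) dotZl mul0r. Qed.

Definition dotE := (dotDl, dotDr, dotNl, dotNr, dotZl, dotZr).

Lemma dot_ge0 p : 0 <= dot p p.
Proof. by rewrite addr_ge0 ?sumr_ge0// => [i _|]; rewrite -expr2 sqr_ge0. Qed.

Lemma enorm_ge0 p : 0 <= enorm p. Proof. exact: sqrtr_ge0. Qed.

Lemma enorm_sqr p : enorm p ^+ 2 = dot p p.
Proof. by rewrite sqr_sqrtr ?dot_ge0. Qed.

Lemma enorm_le p c : 0 <= c -> (enorm p <= c) = (dot p p <= c ^+ 2).
Proof. by move=> c0; rewrite -(@ler_pXn2r _ 2) ?nnegrE ?enorm_ge0// enorm_sqr. Qed.

Lemma enorm_ge p c : 0 <= c -> (c <= enorm p) = (c ^+ 2 <= dot p p).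
Proof. by move=> c0; rewrite -(@ler_pXn2r _ 2) ?nnegrE ?enorm_ge0// enorm_sqr. Qed.

Lemma enormZ c p : enorm (c *: p) = `|c| * enorm p.
Proof. by rewrite /enorm dotZl dotZr mulrA -expr2 sqrtrM ?sqr_ge0// sqrtr_sqr. Qed.

Lemma enormN p : enorm (- p) = enorm p.
Proof. by rewrite -scaleN1r enormZ normrN1 mul1r. Qed.

Lemma enorm0 : enorm (0 : X) = 0.
Proof. by rewrite /enorm dot0l sqrtr0. Qed.

Lemma dot_le_enorm p q : dot p q <= enorm p * enorm q.
Proof.
apply/ler_addgt0Pr => e e0.
have [k k0 ke] : exists2 k : R, 0 < k & k * (enorm p + enorm q + k) <= e.
  have d0 : 0 < e + 1 + enorm p + enorm q.
    by have := enorm_ge0 p; have := enorm_ge0 q; lra.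
  exists (e / (e + 1 + enorm p + enorm q)); first by rewrite divr_gt0.
  rewrite mulrAC ler_pdivrMr// ler_wpM2l ?ltW//.
  have : e / (e + 1 + enorm p + enorm q) <= 1.
    by rewrite ler_pdivrMr//; have := enorm_ge0 p; have := enorm_ge0 q; lra.
  by lra.
apply: le_trans (_ : (enorm p + k) * (enorm q + k) <= _); last by lra.
have := dot_ge0 ((enorm q + k) *: p - (enorm p + k) *: q).
rewrite !dotE -!enorm_sqr (dotC q p).
set a := enorm p; set b := enorm q; set s := dot p q => h.
have a0 : 0 <= a by exact: enorm_ge0.
have b0 : 0 <= b by exact: enorm_ge0.
rewrite -subr_ge0 -(@pmulr_rge0 _ ((a + k) * (b + k))); last by rewrite mulr_gt0//; lra.
have : 0 <= k * (b + k) ^+ 2 * (2 * a + k) + k * (a + k) ^+ 2 * (2 * b + k).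
  by rewrite addr_ge0// !mulr_ge0 ?sqr_ge0//; lra.
by nra.
Qed.

Lemma dot_ge_enorm p q : - (enorm p * enorm q) <= dot p q.
Proof. by rewrite lerNl -dotNl -(enormN p) dot_le_enorm. Qed.

Lemma enormD p q : enorm (p + q) <= enorm p + enorm q.
Proof.
rewrite enorm_le ?addr_ge0 ?enorm_ge0// !dotE (dotC q p) -!enorm_sqr.
by have := dot_le_enorm p q; nra.
Qed.

Lemma coord_le_enorm p i : `|p.1 ord0 i| <= enorm p.
Proof.
rewrite -(@ler_pXn2r _ 2) ?nnegrE ?enorm_ge0// enorm_sqr real_normK ?num_real//.
rewrite /dot (bigD1 i)//= -expr2 -addrA lerDl addr_ge0//; last by rewrite -expr2 sqr_ge0.
by apply: sumr_ge0 => j _; rewrite -expr2 sqr_ge0.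
Qed.

Lemma snd_le_enorm p : `|p.2| <= enorm p.
Proof.
rewrite -(@ler_pXn2r _ 2) ?nnegrE ?enorm_ge0// enorm_sqr real_normK ?num_real//.
by rewrite /dot -expr2 lerDr sumr_ge0// => i _; rewrite -expr2 sqr_ge0.
Qed.

Lemma norm_le_enorm p : `|p| <= enorm p.
Proof.
rewrite prod_normE ge_max snd_le_enorm andbT.
rewrite [leLHS]mx_normrE (bigmax_le _ (enorm_ge0 p))// => -[i j] _ /=.
by rewrite ord1 coord_le_enorm.
Qed.

End EuclideanStructure.

Section TestFunctions.
Context {R : realType} {V : normedModType R}.
Implicit Types f g : V -> R.

Definition C1 (f : V -> R) (df : V -> V -> R) :=
  (forall z, is_diff z f (df z)) /\ forall v, continuous (fun z => df z v).

Lemma C1_Ck f df : C1 f df -> forall U, Ck 1%N U f.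
Proof.
move=> [fd dfc] U; split=> [z _|v z _].
  by case: (fd z).
have -> : (fun z => 'D_v f z) = (fun z => df z v); last exact: dfc.
apply/funext => x; rewrite deriveE; last by case: (fd x).
by have dfx := fd x; rewrite diff_val.
Qed.

Lemma C1_continuous f df : C1 f df -> continuous f.
Proof. by move=> [fd _] z; apply: differentiable_continuous; case: (fd z). Qed.

Lemma C1_ext f df g dg : C1 f df -> f =1 g -> df =2 dg -> C1 g dg.
Proof. by move=> fdf /funext <- H; suff <- : df = dg by []; apply/funext => z; apply/funext/H. Qed.

Lemma C1_cst c : C1 (fun _ => c) (fun _ _ => 0).
Proof. by split=> [z|v]; [exact: is_diff_cst|move=> z; exact: cvg_cst]. Qed.

Lemma C1D f df g dg : C1 f df -> C1 g dg ->
  C1 (fun z => f z + g z) (fun z v => df z v + dg z v).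
Proof.
move=> [fd dfc] [gd dgc]; split=> [z|v z]; last by apply: cvgD; [exact: dfc|exact: dgc].
by have := fd z; have := gd z => ? ?; exact: is_diffD.
Qed.

Lemma C1M f df g dg : C1 f df -> C1 g dg ->
  C1 (fun z => f z * g z) (fun z v => f z * dg z v + g z * df z v).
Proof.
move=> F G; have fc := C1_continuous F; have gc := C1_continuous G.
move: F G => [fd dfc] [gd dgc]; split=> [z|v z].
  by have := fd z; have := gd z => ? ?; exact: is_diffM.
by apply: cvgD; apply: cvgM; [exact: fc|exact: dgc|exact: gc|exact: dfc].
Qed.

Lemma C1Z c f df : C1 f df -> C1 (fun z => c * f z) (fun z v => c * df z v).
Proof.
move=> F; apply: C1_ext (C1M (C1_cst c) F) _ _ => // z v.
by rewrite mulr0 addr0.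
Qed.

Lemma C1_sum (I : Type) (s : seq I) (f : I -> V -> R) (df : I -> V -> V -> R) :
  (forall i, C1 (f i) (df i)) ->
  C1 (fun z => \sum_(i <- s) f i z) (fun z v => \sum_(i <- s) df i z v).
Proof.
move=> F; elim: s => [|i s IHs].
  by apply: C1_ext (C1_cst 0) _ _ => [z|z v]; rewrite big_nil.
by apply: C1_ext (C1D (F i) IHs) _ _ => [z|z v]; rewrite big_cons.
Qed.

Lemma C1_comp (h h' : R -> R) f df : C1 f df -> continuous h' ->
  (forall x : R, is_derive x 1 h (h' x)) ->
  C1 (fun z => h (f z)) (fun z v => h' (f z) * df z v).
Proof.
move=> F hc hd; have fc := C1_continuous F; case: F => [fd dfc].
split=> [z|v z].
  have := fd z => ?.
  have ? : is_diff (f z) h (fun x => x *: h' (f z)).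
    have hd' := hd (f z).
    apply: DiffDef; first by apply/derivable1_diffP; exact: ex_derive.
    by apply/funext => x; rewrite diff1E ?derive1E ?derive_val//; apply/derivable1_diffP; exact: ex_derive.
  have H : is_diff z (h \o f) ((fun x => x *: h' (f z)) \o df z) by exact: is_diff_comp.
  suff -> : (fun v => h' (f z) * df z v) = (fun x => x *: h' (f z)) \o df z by [].
  by apply/funext => v /=; rewrite mulrC.
apply: cvgM; last exact: dfc.
by apply: cvg_comp; [exact: fc|exact: hc].
Qed.

End TestFunctions.
Section LinearTestFunctions.
Context {R : realType} {V : normedModType R}.

Lemma C1_linear (l : V -> R) : linear l -> continuous l -> C1 l (fun _ => l).
Proof.
move=> ll lc; split=> [z|v z]; last exact: cvg_cst.
pose lM := GRing.isLinear.Build _ _ _ _ _ ll.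
pose L : {linear V -> R} := HB.pack l lM.
by apply: DiffDef; [exact: (@linear_differentiable _ _ _ L)|exact: (@diff_lin _ _ _ L)].
Qed.

Lemma C1_sqr_affine (l : V -> R) (c : R) : linear l -> continuous l ->
  C1 (fun z => (l z - c) * (l z - c)) (fun z v => 2 * ((l z - c) * l v)).
Proof.
move=> ll lc; have F := C1D (C1_linear ll lc) (C1_cst (- c)).
by apply: C1_ext (C1M F F) _ _ => // z v; ring.
Qed.

Lemma C1_dot_affine (n : nat) (L : V -> euclid R n) (c : euclid R n) :
  linear L -> continuous L ->
  C1 (fun z => dot (L z - c) (L z - c)) (fun z v => 2 * dot (L z - c) (L v)).
Proof.
move=> ll lc.
have L1l i : linear (fun z => (L z).1 ord0 i).
  by move=> a x y; rewrite ll /= !mxE.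
have L1c i : continuous (fun z => (L z).1 ord0 i).
  move=> z; apply: (@cvg_comp _ _ _ (fst \o L) (fun M : 'rV[R]_n.-1 => M ord0 i) _
    (nbhs (L z).1)); last exact: coord_continuous.
  by apply: cvg_comp; [exact: lc|exact: cvg_fst].
have L2l : linear (fun z => (L z).2) by move=> a x y; rewrite ll.
have L2c : continuous (fun z => (L z).2).
  by move=> z; apply: cvg_comp; [exact: lc|exact: cvg_snd].
apply: C1_ext (C1D (C1_sum (index_enum 'I_n.-1)
   (fun i => C1_sqr_affine (c.1 ord0 i) (L1l i) (L1c i))) (C1_sqr_affine c.2 L2l L2c)) _ _.
  by move=> z; rewrite /dot; congr (_ + _); apply: eq_bigr => i _; rewrite /= !mxE.
move=> z v; rewrite /dot -mulr_sumr -mulrDr; congr (_ * (_ + _)).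
by apply: eq_bigr => i _; rewrite /= !mxE.
Qed.

Lemma C1_expR (f : V -> R) df : C1 f df ->
  C1 (fun z => expR (f z)) (fun z v => expR (f z) * df z v).
Proof. by move=> F; apply: (C1_comp F (@continuous_expR R)) => x; exact: is_derive_expR. Qed.

End LinearTestFunctions.

Section Evolution.
Context {R : realType} {n : nat}.
Local Notation X := (euclid R n).

Lemma dot_row (p : X) : (\row_i dot p (delta_mx ord0 i, 0), dot p (0, 1)) = p.
Proof.
case: p => a b; congr (_, _).
  apply/rowP => j; rewrite mxE /dot /= mulr0 addr0 (bigD1 j)//= big1 ?addr0.
    by rewrite mxE !eqxx mulr1.
  by move=> i ij; rewrite mxE eqxx /= (negPf ij) mulr0.
rewrite /dot /= big1 ?add0r ?mulr1// => i _.
by rewrite mxE mulr0.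
Qed.

Lemma grad_C1 (f : X -> R) df (z : X) p : C1 f df -> (forall v, df z v = dot p v) ->
  grad f z = p.
Proof.
move=> [fd _] dfz; rewrite -[RHS]dot_row /grad; have fdz := fd z.
have D w : 'D_w f z = dot p w by rewrite deriveE ?diff_val ?dfz//; case: fdz.
by rewrite D; congr (_, _); apply/rowP => i; rewrite !mxE D.
Qed.

Lemma evolution_C1 H (f : X * R -> R) df (z : X * R) p q : C1 f df ->
  (forall v, df z v = dot p v.1 + q * v.2) -> evolution H f z = q + H z p.
Proof.
move=> [fd _] dfz; have fdz := fd z; rewrite /evolution; congr (_ + H z _).
  transitivity ('D_(0 : X, 1) f z).
    rewrite derive1E /derive;
    set F := (X in lim (X @ _) = _); set G := (X in _ = lim (X @ _)).
    suff -> : F = G by []; apply/funext => h; rewrite /F /G /=.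
    suff -> : h *: ((0 : X), (1 : R)) + z = (z.1, h *: 1 + z.2) by case: (z).
    by apply: injective_projections; rewrite /= ?scaler0 ?add0r.
  by rewrite deriveE ?diff_val ?dfz /= 1?dotC ?dot0l ?add0r ?mulr1//; case: fdz.
have D w : 'D_w (fun x => f (x, z.2)) z.1 = dot p w.
  transitivity ('D_(w, 0 : R) f z).
    rewrite /derive;
    set F := (X in lim (X @ _) = _); set G := (X in _ = lim (X @ _)).
    suff -> : F = G by []; apply/funext => h; rewrite /F /G /=.
    suff -> : h *: (w, (0 : R)) + z = (h *: w + z.1, z.2) by case: (z).
    by apply: injective_projections; rewrite /= ?scaler0 ?add0r.
  by rewrite deriveE ?diff_val ?dfz /= ?mulr0 ?addr0//; case: fdz.
rewrite /grad -[RHS]dot_row D; congr (_, _).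
by apply/rowP => i; rewrite !mxE D.
Qed.

Lemma linear_fst : linear (fst : X * R -> X). Proof. by []. Qed.

Lemma continuous_fst : continuous (fst : X * R -> X).
Proof. by move=> z; exact: cvg_fst. Qed.

Lemma C1_time : C1 (snd : X * R -> R) (fun _ => snd).
Proof. by apply: C1_linear => // z; exact: cvg_snd. Qed.

Lemma C1_dist (c : X) :
  C1 (fun z : X * R => dot (z.1 - c) (z.1 - c)) (fun z v => 2 * dot (z.1 - c) v.1).
Proof. exact: (C1_dot_affine c linear_fst continuous_fst). Qed.

End Evolution.
Section CompactExtrema.
Context {R : realType} {T : topologicalType}.

Lemma compact_argmax (K : set T) (f : T -> R) : compact K -> K !=set0 ->
  (forall z, K z -> {for z, continuous f}) ->
  exists2 z, K z & forall z', K z' -> f z' <= f z.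
Proof.
move=> cK K0 fc; have := @compact_EVT_max T R f K K0 cK.
case=> [|z]; last by rewrite inE => Kz fz; exists z => // z' Kz'; apply: fz; rewrite inE.
by apply: continuous_in_subspaceT => z; rewrite inE; exact: fc.
Qed.

Lemma compact_upper_bound (K : set T) (f : T -> R) : compact K ->
  (forall z, K z -> {for z, continuous f}) ->
  exists2 M : R, 0 < M & forall z, K z -> f z <= M.
Proof.
move=> cK fc; have [->|/set0P K0] := eqVneq K set0; first by exists 1.
have [z Kz fz] := compact_argmax cK K0 fc.
exists (`|f z| + 1); first by rewrite ltr_wpDl.
by move=> z' /fz /le_trans; apply; have := ler_norm (f z); lra.
Qed.

End CompactExtrema.

Section SmoothComparison.
Context {R : realType} {V : normedModType R}.
Variables (U : set V) (A : (V -> R) -> V -> R) (K O : set V).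
Hypotheses (cK : compact K) (oO : open O) (OK : O `<=` K) (KU : K `<=` U).

Lemma subsolution_le_smooth f phi dphi : viscosity_subsolution U A f ->
  C1 phi dphi -> (forall z, O z -> 0 < A phi z) ->
  (forall z, K z -> ~ O z -> f z <= phi z) -> forall z, K z -> f z <= phi z.
Proof.
move=> [fc fsub] phiC1 Aphi fphi z0 Kz0.
have hc z : K z -> {for z, continuous (fun z => f z - phi z)}.
  by move=> Kz; apply: cvgB; [exact/fc/KU|exact: (C1_continuous phiC1)].
have [z Kz hz] := compact_argmax cK (ex_intro _ z0 Kz0) hc.
have := hz _ Kz0; rewrite /= => /le_trans h.
suff : f z - phi z <= 0 by move/h; rewrite subr_le0.
have [Oz|nOz] := pselect (O z); last by rewrite subr_le0 fphi.
have := Aphi z Oz; rewrite ltNge fsub//.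
- exact: KU.
- exact: C1_Ck phiC1 _.
- by apply: filterS (open_nbhs_nbhs (conj oO Oz)) => z' /OK /hz.
Qed.

End SmoothComparison.

Section SpaceTime.
Context {R : realType} {n : nat}.
Local Notation X := (euclid R n).
Local Notation expR := (@expR R).

Definition test (f : X * R -> R) (p : X * R -> X) (q : X * R -> R) :=
  C1 f (fun z v => dot (p z) v.1 + q z * v.2).

Lemma test_ext f p q g p' q' : test f p q -> f =1 g -> p =1 p' -> q =1 q' -> test g p' q'.
Proof. by move=> F fg pp qq; apply: C1_ext F fg _ => z v; rewrite pp qq. Qed.

Lemma evolution_test H f p q z : test f p q -> evolution H f z = q z + H z (p z).
Proof. by move=> F; apply: evolution_C1 F _. Qed.

(* Supersolutions tested only against globally C^1 functions: unlike
   viscosity_supersolution, this class is easily seen to be stable under an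
   exponential change of the unknown. *)
Definition test_supersolution (H : X * R -> X -> R) (g : X * R -> R) :=
  (forall z, @upper R X z -> {for z, continuous g}) /\
  forall phi p q z, @upper R X z -> test phi p q ->
    (\forall z' \near z, g z - phi z <= g z' - phi z') -> 0 <= q z + H z (p z).

Lemma viscosity_test_supersolution H g :
  viscosity_supersolution (@upper R X) (evolution H) g -> test_supersolution H g.
Proof.
move=> [gc gsup]; split=> // phi p q z Uz F loc.
by rewrite -(evolution_test _ _ F); apply: gsup loc => //; exact: C1_Ck F _.
Qed.

Lemma test_cst c : test (fun _ => c) (fun _ => 0) (fun _ => 0).
Proof. by apply: C1_ext (C1_cst c) _ _ => // z v; rewrite dot0l mul0r addr0. Qed.

Lemma test_time : test snd (fun _ => 0) (fun _ => 1).
Proof. by apply: C1_ext C1_time _ _ => // z v; rewrite dot0l mul1r add0r. Qed.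

Lemma test_dist c : test (fun z => dot (z.1 - c) (z.1 - c))
  (fun z => 2 *: (z.1 - c)) (fun _ => 0).
Proof. by apply: C1_ext (C1_dist c) _ _ => // z v; rewrite dotZl mul0r addr0. Qed.

Lemma testD f p q g p' q' : test f p q -> test g p' q' ->
  test (fun z => f z + g z) (fun z => p z + p' z) (fun z => q z + q' z).
Proof.
by move=> F G; apply: C1_ext (C1D F G) _ _ => // z v; rewrite dotDl mulrDl addrACA.
Qed.

Lemma testZ c f p q : test f p q ->
  test (fun z => c * f z) (fun z => c *: p z) (fun z => c * q z).
Proof. by move=> F; apply: C1_ext (C1Z c F) _ _ => // z v; rewrite dotZl mulrDr mulrA. Qed.

Lemma testM f p q g p' q' : test f p q -> test g p' q' ->
  test (fun z => f z * g z) (fun z => f z *: p' z + g z *: p z)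
       (fun z => f z * q' z + g z * q z).
Proof.
by move=> F G; apply: C1_ext (C1M F G) _ _ => // z v; rewrite dotDl !dotZl; ring.
Qed.

Lemma test_expR f p q : test f p q ->
  test (fun z => expR (f z)) (fun z => expR (f z) *: p z) (fun z => expR (f z) * q z).
Proof. by move=> F; apply: C1_ext (C1_expR F) _ _ => // z v; rewrite dotZl; ring. Qed.

Definition barrier (s N T : R) (z : X * R) := s * expR (N * (z.2 - T)).

Lemma test_barrier s N T : test (barrier s N T) (fun _ => 0)
  (fun z => s * N * expR (N * (z.2 - T))).
Proof.
apply: test_ext (testZ s (test_expR (testZ N (testD test_time (test_cst (- T)))))) _ _ _ => //.
  by move=> z; rewrite !(scaler0, addr0).
by move=> z /=; ring.
Qed.

Lemma barrier_vanishes (a b s d : R) : 0 < d -> 0 <= s ->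
  (forall N, 0 < N -> a <= b + s * expR (N * - d)) -> a <= b.
Proof.
move=> d0 s0 h; apply/ler_addgt0Pr => e e0.
have N0 : 0 < (s + 1) / (e * d) by rewrite divr_gt0 ?mulr_gt0 ?ltr_wpDl.
apply: le_trans (h _ N0) _; rewrite lerD2l.
have -> : (s + 1) / (e * d) * - d = - ((s + 1) / e).
  by field; rewrite !gt_eqF.
rewrite expRN ler_pdivrMr ?expR_gt0//.
apply: le_trans (ler_wpM2l (ltW e0) (expR_ge1Dx _)).
by rewrite mulrDr mulrCA divff ?gt_eqF//; lra.
Qed.

End SpaceTime.

Section ParabolicComparison.
Context {R : realType} {n : nat}.
Local Notation X := (euclid R n).
Variables (K O : set (X * R)) (T : R).
Hypotheses (cK : compact K) (oO : open O) (KU : K `<=` @upper R X).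
Hypothesis OK : forall z, O z -> z.2 < T -> K z.
Hypothesis KT : forall z, K z -> z.2 <= T.

Let OT := O `&` [set z | z.2 < T].

Lemma open_before : open OT.
Proof.
apply: openI => //.
have -> : [set z : X * R | z.2 < T] = snd @^-1` [set t : R | t < T] by [].
by apply: open_comp; [move=> z _; exact: cvg_snd|exact: open_lt].
Qed.

Lemma subsolution_le_test H f phi p q :
  viscosity_subsolution (@upper R X) (evolution H) f -> test phi p q ->
  (forall z, O z -> z.2 < T -> 0 < q z + H z (p z)) ->
  (forall z, K z -> ~ O z -> f z <= phi z) ->
  forall z, K z -> z.2 < T -> f z <= phi z.
Proof.
move=> fsub phiT Hphi fphi.
have [M M0 hM] : exists2 M : R, 0 < M & forall z, K z -> f z - phi z <= M.
  apply: compact_upper_bound => // z Kz.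
  by apply: cvgB; [exact/(proj1 fsub)/KU|exact: (C1_continuous phiT)].
move=> z0 Kz0 z0T; apply: (@barrier_vanishes _ _ _ M (T - z0.2)) => [||N N0].
- by rewrite subr_gt0.
- exact: ltW.
have F := testD phiT (test_barrier M N T).
have := @subsolution_le_smooth _ _ _ _ K OT cK open_before _ KU f _ _ fsub F _ _ z0 Kz0.
rewrite /barrier opprB; apply.
- by move=> z [Oz zT]; exact: OK.
- move=> z [Oz zT]; rewrite (evolution_test _ _ F) addr0 addrAC ltr_wpDr ?Hphi//.
  by rewrite !mulr_ge0 ?expR_ge0 ?ltW.
- move=> z Kz nOT /=.
  have [Oz|nOz] := pselect (O z).
    have -> : z.2 = T.
      by apply/le_anti; rewrite KT//= leNgt; apply/negP => zT; exact: nOT.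
    by rewrite subrr mulr0 expR0 mulr1 -lerBlDl hM.
  by rewrite ler_wpDr ?fphi// mulr_ge0 ?expR_ge0 ?ltW.
Qed.

End ParabolicComparison.
Section Doubling.
Context {R : realType} {n : nat}.
Local Notation X := (euclid R n).

Definition sqdist (z z' : X * R) : R := dot (z.1 - z'.1) (z.1 - z'.1) + (z.2 - z'.2) ^+ 2.

Lemma sqdistC z z' : sqdist z z' = sqdist z' z.
Proof. by rewrite /sqdist -(opprB z'.1) dotNl dotNr opprK -(opprB z'.2) sqrrN. Qed.

Lemma sqdist_ge0 z z' : 0 <= sqdist z z'.
Proof. by rewrite addr_ge0 ?dot_ge0 ?sqr_ge0. Qed.

Lemma enorm_st_sqr (z : X * R) : enorm_st z ^+ 2 = dot z.1 z.1 + z.2 ^+ 2.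
Proof. by rewrite sqr_sqrtr// addr_ge0 ?dot_ge0 ?sqr_ge0. Qed.

Lemma enorm_st_ge0 (z : X * R) : 0 <= enorm_st z. Proof. exact: sqrtr_ge0. Qed.

Lemma enorm_le_st (z : X * R) : enorm z.1 <= enorm_st z.
Proof. by rewrite ler_wsqrtr// lerDl sqr_ge0. Qed.

Lemma sqdistE z z' : sqdist z z' = enorm_st (z - z') ^+ 2.
Proof. by rewrite enorm_st_sqr. Qed.

Lemma norm_le_enorm_st (z : X * R) : `|z| <= enorm_st z.
Proof.
rewrite prod_normE ge_max (le_trans (norm_le_enorm _) (enorm_le_st _)) /=.
by rewrite -sqrtr_sqr ler_wsqrtr// lerDr dot_ge0.
Qed.

Lemma test_sqdist z' : test (fun z => sqdist z z')
  (fun z => 2 *: (z.1 - z'.1)) (fun z => 2 * (z.2 - z'.2)).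
Proof.
have F := testD test_time (test_cst (- z'.2) : @test R n _ _ _).
apply: test_ext (testD (test_dist z'.1) (testM F F)) _ _ _ => //.
  by move=> z; rewrite addr0 scaler0 !addr0.
by move=> z /=; ring.
Qed.

Lemma compact_unif_continuous (K : set (X * R)) (g : X * R -> R) (e : R) : compact K ->
  (forall z, K z -> {for z, continuous g}) -> 0 < e ->
  exists2 r : R, 0 < r & forall z z', K z -> K z' -> sqdist z z' < r -> `|g z - g z'| < e.
Proof.
move=> /compact_near_coveringP cK gc e0.
have e20 : 0 < e / 2 by lra.
suff H : \forall r \near 0^'+, K `<=` [set z | forall z', sqdist z z' < r ^+ 2 -> `|g z - g z'| < e].
  have [r [/= r0 Hr]] := filter_ex (filterI (nbhs_right_gt (0 : R)) H).
  by exists (r ^+ 2); [exact: exprn_gt0|move=> z z' Kz _; exact: Hr].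
apply: cK => z Kz.
have /cvgrPdist_lt/(_ _ e20)/nbhs_ballP[d /= d0 hd] := gc z Kz.
exists (ball z (d / 2), [set r | 0 < r < d / 2]); first split.
- by apply: nbhsx_ballx; lra.
- by near=> r; apply/andP; split; near: r; [exact: nbhs_right_gt|apply: nbhs_right_lt; lra].
case=> z' r /= [zz' /andP[r0 rd]] z'' D.
have z'z'' : `|z' - z''| < d / 2.
  apply: le_lt_trans (norm_le_enorm_st _) _; apply: lt_trans rd.
  by rewrite -(@ltr_pXn2r _ 2) ?nnegrE ?enorm_st_ge0 ?(ltW r0)// -sqdistE.
have h1 : `|g z - g z'| < e / 2.
  by apply: hd; apply: le_ball zz'; lra.
have h2 : `|g z - g z''| < e / 2.
  apply: hd; rewrite (splitr d); apply: ball_triangle zz' _.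
  by rewrite -ball_normE.
have -> : g z' - g z'' = - (g z - g z') + (g z - g z'') by lra.
by rewrite (le_lt_trans (ler_normD _ _))// normrN; lra.
Unshelve. all: by end_near.
Qed.

Section Comparison.
Variables (H : X * R -> X -> R) (f g : X * R -> R).
Hypothesis fsub : viscosity_subsolution (@upper R X) (evolution H) f.
Hypothesis gsup : test_supersolution H g.
Variables (K O : set (X * R)) (lam L c : R).
Hypotheses (cK : compact K) (oO : open O) (KU : K `<=` @upper R X).
Hypotheses (lam0 : 0 < lam) (L0 : 0 <= L) (c0 : 0 < c).
Hypothesis HL : forall z z' p, K z -> K z' ->
  H z' p <= H z p + L * enorm_st (z - z') * enorm p.

Lemma doubling Psi P Q : O `<=` K -> test Psi P Q ->
  (forall z (p : X), O z -> H z (lam *: p - P z) <= lam * H z p + Q z - c) ->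
  (forall z, K z -> ~ O z -> lam * f z - g z <= Psi z) ->
  forall z, K z -> lam * f z - g z <= Psi z.
Proof.
move=> OK PsiT Hstr bnd z1 Kz1.
pose F z := lam * f z - Psi z.
have Fc z : K z -> {for z, continuous F}.
  move=> Kz; apply: cvgB; last exact: (C1_continuous PsiT).
  by apply: cvgM; [exact: cvg_cst|exact/(proj1 fsub)/KU].
have gc z : K z -> {for z, continuous g} by move=> Kz; exact/(proj1 gsup)/KU.
have Fgc z : K z -> {for z, continuous (fun z => F z - g z)}.
  by move=> Kz; apply: cvgB; [exact: Fc|exact: gc].
have [z0 Kz0 hz0] := compact_argmax cK (ex_intro _ z1 Kz1) Fgc.
have [m mE] : exists m, F z0 - g z0 = m by exists (F z0 - g z0).
rewrite /= mE in hz0; have h1 := hz0 z1 Kz1.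
rewrite -subr_le0; apply: le_trans (_ : m <= 0); first by rewrite addrAC.
rewrite leNgt; apply/negP => m0.
pose e : R := Num.min m (c / (2 * L + 1)).
have d0 : 0 < 2 * L + 1.
  by rewrite ltr_wpDl ?mulr_ge0.
have e0 : 0 < e by rewrite lt_min m0 divr_gt0.
have em : e <= m by rewrite ge_min lexx.
have ec : e * (2 * L + 1) <= c.
  by rewrite -ler_pdivlMr// ge_min lexx orbT.
have [r1 r10 ur1] := compact_unif_continuous cK Fc e0.
have [r2 r20 ur2] := compact_unif_continuous cK gc e0.
have [B1 B10 hB1] := compact_upper_bound cK Fc.
have ngc z : K z -> {for z, continuous (fun z => - g z)} by move=> /gc; exact: cvgN.
have [B2 B20 hB2] := compact_upper_bound cK ngc.
pose r : R := Num.min r1 r2.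
have r0 : 0 < r by rewrite lt_min r10.
have [k k0 kr] : exists2 k : R, 0 < k & k * r = B1 + B2.
  by exists ((B1 + B2) / r); [rewrite divr_gt0// addr_gt0|rewrite divfK ?gt_eqF].
pose Phi (w : (X * R) * (X * R)) := F w.1 - g w.2 - k * sqdist w.1 w.2.
have Phic w : (K `*` K) w -> {for w, continuous Phi}.
  case: w => w1 w2 [/= Kw1 Kw2].
  apply: cvgB; first apply: cvgB.
  - by apply: (@cvg_comp _ _ _ fst F _ (nbhs w1)); [exact: cvg_fst|exact: Fc].
  - by apply: (@cvg_comp _ _ _ snd g _ (nbhs w2)); [exact: cvg_snd|exact: gc].
  apply: cvgM; first exact: cvg_cst.
  have sc : continuous (fun w : (X * R) * (X * R) => sqdist w.1 w.2).
    have -> : (fun w : (X * R) * (X * R) => sqdist w.1 w.2) = (fun w => sqdist (w.1 - w.2) 0).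
      by apply/funext => w; rewrite /sqdist /= !subr0.
    move=> w; apply: (@cvg_comp _ _ _ (fun w => w.1 - w.2) (fun z => sqdist z 0) _ (nbhs (w.1 - w.2))).
      by apply: cvgB; [exact: cvg_fst|exact: cvg_snd].
    exact: (C1_continuous (test_sqdist 0)).
  exact: (sc (w1, w2)).
have [[z z'] [/= Kz Kz'] hw] := compact_argmax (compact_setX cK cK)
  (ex_intro _ (z1, z1) (conj Kz1 Kz1)) Phic.
have s0 := sqdist_ge0 z z'.
have hm : m <= F z - g z' - k * sqdist z z'.
  have := hw (z0, z0) (conj Kz0 Kz0).
  by rewrite /Phi /= mE {1}/sqdist !subrr dot0l expr0n addr0 mulr0 subr0.
have Dr : sqdist z z' < r.
  have : k * sqdist z z' < k * r.
    rewrite kr.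
    by have := hB1 z Kz; have /= := hB2 z' Kz'; lra.
  by rewrite ltr_pM2l.
have hF : `|F z - F z'| < e by apply: ur1 => //; rewrite (lt_le_trans Dr)// ge_min lexx.
have hg : `|g z - g z'| < e by apply: ur2 => //; rewrite (lt_le_trans Dr)// ge_min lexx orbT.
have kD0 : 0 <= k * sqdist z z' by rewrite mulr_ge0// ltW.
have kD : k * sqdist z z' < e.
  have /= := hz0 z Kz; have := ler_norm (g z - g z'); lra.
have Oz : O z.
  apply: contrapT => /(bnd _ Kz) h; have := ler_norm (g z - g z'); rewrite /F in hm; lra.
have Oz' : O z'.
  apply: contrapT => /(bnd _ Kz') h; have := ler_norm (F z - F z'); rewrite /F in hm hF *; lra.
pose w : X := (2 * k) *: (z.1 - z'.1).
have T1 := testZ lam^-1 (testD PsiT (testZ k (test_sqdist z'))).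
have T2 := testZ (- k) (test_sqdist z).
have hsub : evolution H (fun x => lam^-1 * (Psi x + k * sqdist x z')) z <= 0.
  apply: (proj2 fsub); [exact: KU|exact: C1_Ck T1 _|].
  apply: filterS (open_nbhs_nbhs (conj oO Oz)) => x /OK Kx.
  have := hw (x, z') (conj Kx Kz'); rewrite /Phi /F /= => h.
  rewrite -(ler_pM2l lam0) !mulrBr !mulrA divff ?gt_eqF// !mul1r; lra.
have hsup := proj2 gsup _ _ _ z' (KU Kz') T2.
have {}hsup : 0 <= - k * (2 * (z'.2 - z.2)) + H z' (- k *: (2 *: (z'.1 - z.1))).
  apply: hsup.
  apply: filterS (open_nbhs_nbhs (conj oO Oz')) => x /OK Kx.
  have := hw (z, x) (conj Kz Kx); rewrite /Phi /= !(sqdistC _ z) => h.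
  lra.
move: hsub hsup; rewrite (evolution_test _ _ T1).
have -> : - k *: (2 *: (z'.1 - z.1)) = w by rewrite -(opprB z.1) !scalerN scaleNr opprK scalerA mulrC.
set p := lam^-1 *: _.
have pw : lam *: p - P z = w.
  by rewrite /p !scalerA divff ?gt_eqF// scale1r addrC addKr mulrC.
move=> hsub hsup; have := Hstr z p Oz; rewrite pw => h.
have h2 : Q z + k * (2 * (z.2 - z'.2)) + lam * H z p <= 0.
  have := ler_wpM2l (ltW lam0) hsub.
  by rewrite mulr0 mulrDr; rewrite [X in X + _]mulrA [X in X * _ + _]divff ?gt_eqF// mul1r.
have := HL w Kz Kz'.
have : L * enorm_st (z - z') * enorm w <= 2 * L * (k * sqdist z z').
  rewrite /w enormZ ger0_norm ?mulr_ge0 ?(ltW k0)//.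
  have := enorm_le_st (z - z'); rewrite sqdistE /= => h3.
  have -> : 2 * L * (k * enorm_st (z - z') ^+ 2) =
    L * enorm_st (z - z') * (2 * k * enorm_st (z - z')) by ring.
  by rewrite ler_wpM2l ?mulr_ge0 ?enorm_st_ge0// ler_wpM2l// mulr_ge0// ltW.
have : 2 * L * (k * sqdist z z') <= 2 * L * e by rewrite ler_wpM2l ?mulr_ge0// ltW.
move: e0 ec hsup h h2; clear => e0 ec hsup h h2 h3 h4 h5.
lra.
Qed.

End Comparison.
End Doubling.
Section ParabolicDoubling.
Context {R : realType} {n : nat}.
Local Notation X := (euclid R n).
Variables (K O : set (X * R)) (T : R).
Hypotheses (cK : compact K) (oO : open O) (KU : K `<=` @upper R X).
Hypothesis OK : forall z, O z -> z.2 < T -> K z.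
Hypothesis KT : forall z, K z -> z.2 <= T.
Variables (H : X * R -> X -> R) (f g : X * R -> R) (lam L c : R).
Hypothesis fsub : viscosity_subsolution (@upper R X) (evolution H) f.
Hypothesis gsup : test_supersolution H g.
Hypotheses (lam0 : 0 < lam) (L0 : 0 <= L) (c0 : 0 < c).
Hypothesis HL : forall z z' p, K z -> K z' ->
  H z' p <= H z p + L * enorm_st (z - z') * enorm p.

Lemma parabolic_doubling Psi P Q : test Psi P Q ->
  (forall z (p : X), O z -> z.2 < T -> H z (lam *: p - P z) <= lam * H z p + Q z - c) ->
  (forall z, K z -> ~ O z -> lam * f z - g z <= Psi z) ->
  forall z, K z -> z.2 < T -> lam * f z - g z <= Psi z.
Proof.
move=> PsiT Hstr bnd.
have [M M0 hM] : exists2 M : R, 0 < M & forall z, K z -> lam * f z - g z - Psi z <= M.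
  apply: compact_upper_bound => // z Kz.
  apply: cvgB; last exact: (C1_continuous PsiT).
  apply: cvgB; last exact/(proj1 gsup)/KU.
  by apply: cvgM; [exact: cvg_cst|exact/(proj1 fsub)/KU].
move=> z0 Kz0 z0T; apply: (@barrier_vanishes _ _ _ M (T - z0.2)) => [||N N0].
- by rewrite subr_gt0.
- exact: ltW.
have F := testD PsiT (test_barrier M N T).
have := doubling fsub gsup cK (open_before (T := T) oO) KU lam0 L0 c0 HL _ F _ _ Kz0.
rewrite /barrier opprB; apply => {z0 Kz0 z0T}.
- by move=> z [Oz zT]; exact: OK.
- move=> z p [Oz zT]; rewrite addr0; apply: le_trans (Hstr z p Oz zT) _.
  rewrite lerD2r addrA lerDl.
  by rewrite !mulr_ge0 ?expR_ge0 ?ltW.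
- move=> z Kz nOT /=.
  have [Oz|nOz] := pselect (O z).
    have -> : z.2 = T.
      by apply/le_anti; rewrite KT//= leNgt; apply/negP => zT; exact: nOT.
    by rewrite subrr mulr0 expR0 mulr1 -lerBlDl hM.
  by rewrite ler_wpDr ?bnd// mulr_ge0 ?expR_ge0 ?ltW.
Qed.

End ParabolicDoubling.
Section Regions.
Context {R : realType} {n : nat}.
Local Notation X := (euclid R n).

Lemma ball_compact (B : R) : compact [set z : X | `|z| <= B].
Proof.
have -> : [set z : X | `|z| <= B] =
    [set M : 'rV[R]_n.-1 | `|M| <= B] `*` [set y : R | `|y| <= B].
  by apply/seteqP; split=> z /=; rewrite prod_normE ge_max => /andP.
have cl (W : normedModType R) : closed [set z : W | `|z| <= B].
  apply: (@preimage_closed _ _ (Num.norm : W -> R) [set t : R | t <= B]); last exact: closed_le.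
  by move=> z _; exact: norm_continuous.
apply: compact_setX.
  apply: bounded_closed_compact; last exact: cl.
  by exists B; split=> [|x Bx z /= /le_trans]; [exact: num_real|apply; exact: ltW].
have -> : [set y : R | `|y| <= B] = `[- B, B]%classic.
  by apply/seteqP; split=> y /=; rewrite in_itv /= ler_norml.
exact: segment_compact.
Qed.

Variables (Qf : X * R -> R) (r s T B : R).
Hypothesis Qc : continuous Qf.

Definition region := [set z : X * R | s <= z.2 <= T /\ Qf z <= r].
Definition region_interior := [set z : X * R | s < z.2 /\ Qf z < r].

Lemma region_compact : (forall z, region z -> enorm z.1 <= B) -> compact region.
Proof.
move=> hB; have tc : continuous (snd : X * R -> R) by move=> z; exact: cvg_snd.
apply: (@subclosed_compact _ _ ([set z : X | `|z| <= B] `*` `[s, T]%classic)).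
- have -> : region = (snd @^-1` [set t | s <= t]) `&` (snd @^-1` [set t | t <= T]) `&`
      (Qf @^-1` [set t | t <= r]).
    by apply/seteqP; split=> z; [move=> [/andP[]]|move=> [[h1 h2] h3]; split=> //; apply/andP].
  apply: closedI; first apply: closedI; apply: preimage_closed.
  + by move=> z _; exact: tc.
  + exact: closed_ge.
  + by move=> z _; exact: tc.
  + exact: closed_le.
  + by move=> z _; exact: Qc.
  + exact: closed_le.
- by apply: compact_setX; [exact: ball_compact|exact: segment_compact].
- move=> z Kz; split=> /=; first exact: le_trans (norm_le_enorm _) (hB z Kz).
  by rewrite in_itv /=; case: Kz.
Qed.

Lemma region_interior_open : open region_interior.
Proof.
have tc : continuous (snd : X * R -> R) by move=> z; exact: cvg_snd.
have -> : region_interior = (snd @^-1` [set t | s < t]) `&` (Qf @^-1` [set t | t < r]) by [].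
by apply: openI; apply: open_comp; [move=> z _; exact: tc|exact: open_gt|move=> z _; exact: Qc|exact: open_lt].
Qed.

Lemma interior_region z : region_interior z -> z.2 < T -> region z.
Proof. by move=> [sz Qz] zT; split; rewrite ?(ltW sz) ?(ltW zT) ?ltW. Qed.

Lemma region_le z : region z -> z.2 <= T. Proof. by move=> [/andP[]]. Qed.

Lemma region_upper : 0 < s -> region `<=` @upper R X.
Proof. by move=> s0 z [/andP[sz _] _]; exact: lt_le_trans sz. Qed.

Lemma region_boundary z : region z -> ~ region_interior z -> z.2 = s \/ Qf z = r.
Proof.
move=> [/andP[sz zT] Qz] h; have [zs|zs] := leP z.2 s.
  by left; apply/le_anti; rewrite zs.
right; apply/le_anti; rewrite Qz leNgt; apply/negP => Qzr.
exact: h.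
Qed.

End Regions.

Section Hamiltonians.
Context {R : realType} {n : nat}.
Local Notation X := (euclid R n).
Implicit Type b : X * R -> X.

Definition hamG b (z : X * R) (p : X) : R := dot (b z) p + enorm p.

Definition hamV b (z : X * R) (p : X) : R :=
  dot (b z) p + 2^-1 * enorm p ^+ 2 + 2^-1.

Lemma drift_completed_squares (p a B : X) : dot B B <= (1 / 100) ^+ 2 ->
  0 < - dot p a + dot a a + (dot B p + 2^-1 * dot p p + 2^-1).
Proof.
move=> hB; have := dot_ge0 (a + B); have := dot_ge0 (p - a + B).
rewrite !dotE (dotC a p) (dotC B p) (dotC B a).
by move: hB; lra.
Qed.

Lemma hamV_sub_line b f (z0 z1 : X) (s t : R) :
  (forall z, 0 <= z.2 -> enorm (b z) <= 1 / 100) ->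
  viscosity_subsolution (@upper R X) (evolution (hamV b)) f ->
  0 < s -> s < t ->
  f (z1, t) <= f (z0, s) + dot (z1 - z0) (z1 - z0) / (t - s).
Proof.
move=> hb fsub s0 st; apply/ler_addgt0Pr => eta eta0.
have ts0 : 0 < t - s by rewrite subr_gt0.
pose a : X := (t - s)^-1 *: (z1 - z0).
pose Lf (z : X * R) : X := z.1 - z.2 *: a.
pose c : X := z0 - s *: a.
have ll : linear Lf.
  by move=> k x y; rewrite /Lf /= scalerBr scalerDl -scalerA opprD addrACA.
have lc : continuous Lf.
  move=> z; apply: cvgB; first exact: cvg_fst.
  by apply: cvgZr_tmp; exact: cvg_snd.
pose Qf z := dot (Lf z - c) (Lf z - c).
have QfT : test Qf (fun z => 2 *: (Lf z - c)) (fun z => - (2 * dot (Lf z - c) a)).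
  apply: C1_ext (C1_dot_affine c ll lc) _ _ => // z v.
  by rewrite /Lf dotBr dotZr dotZl; ring.
have Qc := C1_continuous QfT.
pose T := t + 1.
have LE z : z.1 = (Lf z - c) + (c + z.2 *: a) by rewrite /Lf addrA subrK subrK.
have cK : compact (region Qf 1 s T).
  apply: (@region_compact _ _ _ _ _ _ (1 + (enorm c + T * enorm a)) Qc) => z [/andP[sz zT] Qz].
  rewrite (LE z) (le_trans (enormD _ _))// lerD//.
    by rewrite enorm_le// expr1n.
  rewrite (le_trans (enormD _ _))// lerD2l enormZ ger0_norm; last by lra.
  by rewrite ler_wpM2r ?enorm_ge0.
have KU := region_upper (Qf := Qf) (r := 1) (T := T) s0.
have fc z : region Qf 1 s T z -> {for z, continuous f} by move=> Kz; exact/(proj1 fsub)/KU.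
have [M M0 hM] := compact_upper_bound cK fc.
have [r r0 hr] := compact_unif_continuous cK fc eta0.
have [k k0 [kM krM]] : exists2 k : R, 0 <= k & M - f (z0, s) <= k /\ M - f (z0, s) <= k * r.
  have h0 : 0 <= M + `|f (z0, s)| by rewrite addr_ge0// ltW.
  have h1 : 0 <= (M + `|f (z0, s)|) / r by rewrite divr_ge0// ltW.
  have h2 : 0 <= (M + `|f (z0, s)|) * r by rewrite mulr_ge0// ltW.
  exists ((M + `|f (z0, s)|) / r + (M + `|f (z0, s)|)); first by rewrite addr_ge0.
  have := ler_norm (- f (z0, s)); rewrite normrN => h3.
  split; first by lra.
  by rewrite mulrDl divfK ?gt_eqF//; lra.
have start x : Lf (x, s) - c = x - z0.
  by rewrite /Lf /c /= opprB addrA subrK.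
have Qs x : Qf (x, s) = dot (x - z0) (x - z0) by rewrite /Qf start.
have L0 : Lf (z1, t) - c = 0.
  rewrite /Lf /c /= opprB addrA addrAC; apply/eqP.
  rewrite addrAC -(addrA z1) [_ + s *: a]addrC -scalerBl addrAC -(opprB t) scaleNr subr_eq0.
  by rewrite /a scalerA divff ?gt_eqF// scale1r.
have Qt : Qf (z1, t) = 0 by rewrite /Qf L0 dot0l.
have Kz0 : region Qf 1 s T (z0, s).
  by split=> /=; rewrite ?Qs ?subrr ?dot0l ?lexx//= /T; lra.
pose phi z := f (z0, s) + eta + k * Qf z + dot a a * (z.2 - s).
have phiT := testD (testD (test_cst (f (z0, s) + eta)) (testZ k QfT))
  (testZ (dot a a) (testD test_time (test_cst (- s)))).
have main : f (z1, t) <= f (z0, s) + eta + k * Qf (z1, t) + dot a a * (t - s); last first.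
  move: main; rewrite Qt mulr0 addr0.
  have -> : dot a a * (t - s) = dot (z1 - z0) (z1 - z0) / (t - s).
    by rewrite /a dotZl dotZr; field; rewrite gt_eqF.
  by rewrite addrAC.
apply: (subsolution_le_test cK (region_interior_open (r := 1) (s := s) Qc) KU
  (@interior_region _ _ _ _ _ _) (@region_le _ _ _ _ _ _) fsub phiT _ _ (z := (z1, t))).
- move=> z [sz Qz] zT /=; rewrite /hamV !add0r addr0 scaler0 addr0 scalerA.
  set y := Lf z - c; rewrite enorm_sqr.
  have -> : k * - (2 * dot y a) = - dot (k * 2 *: y) a by rewrite dotZl; ring.
  rewrite mulr1; apply: drift_completed_squares.
  by rewrite -enorm_le ?hb ?divr_ge0// ltW// (lt_trans s0).
- move=> z Kz nO; have [/andP[sz _] _] := Kz.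
  have [zs|Q1] := region_boundary Kz nO; last first.
    rewrite Q1 mulr1.
    have := hM z Kz.
    have : 0 <= dot a a * (z.2 - s) by rewrite mulr_ge0 ?dot_ge0 ?subr_ge0.
    lra.
  have [Dr|Dr] := ltP (sqdist z (z0, s)) r.
    have := hr _ _ Kz Kz0 Dr => /(le_lt_trans (ler_norm _)).
    have : 0 <= k * Qf z by rewrite mulr_ge0 ?dot_ge0.
    by rewrite zs subrr mulr0; lra.
  have : k * r <= k * Qf z.
    rewrite ler_wpM2l// (le_trans Dr)//; case: z zs {Kz nO sz Dr} => x t' /= ->.
    by rewrite Qs /sqdist /= subrr expr0n addr0.
  have := hM z Kz; rewrite zs subrr mulr0; lra.
- by split; rewrite /= ?Qt//= /T; lra.
- by rewrite /= /T; lra.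
Qed.

End Hamiltonians.
Section InitialData.
Context {R : realType} {n : nat}.
Local Notation X := (euclid R n).
Implicit Types (rho : X -> R) (x : X).

Lemma solves_IVP_le H v0 v rho x (e : R) : solves_IVP H v0 v ->
  {for x, continuous rho} -> (forall x', v0 x' <= rho x') -> 0 < e ->
  \forall z \near (x, 0), 0 <= z.2 -> v z <= rho x + e.
Proof.
move=> [_ _ hv _] rhoc v0rho e0.
have e20 : 0 < e / 2 by lra.
have : (limf_esup (EFin \o v) (within (@upper_closed R X) (nbhs ((x, 0%R) : X * R)))
    < (rho x + e)%:E)%E.
  apply: le_lt_trans (hv x) _.
  apply: (@le_lt_trans _ _ (rho x + e / 2)%:E); last by rewrite lte_fin; lra.
  pose A := [set x' | rho x' < rho x + e / 2].
  apply: ge_ereal_inf; exists (ereal_sup [set (EFin \o v0) x' | x' in A]).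
    exists A => //; apply: (rhoc [set t | t < rho x + e / 2]).
    by apply: lt_nbhsl; lra.
  apply: ge_ereal_sup => _ [x' Ax' <-] /=; rewrite lee_fin.
  exact: le_trans (v0rho x') (ltW Ax').
case/ereal_inf_lt => _ [B nB <-] hB.
have {}nB : \forall z \near ((x, 0) : X * R), upper_closed z -> B z := nB.
apply: filterS nB => z Bz z0.
rewrite -lee_fin; apply: le_trans _ (ltW hB).
by apply: ereal_sup_ubound; exists z => //; exact: Bz.
Qed.

Lemma solves_IVP_ge H v0 v rho x (e : R) : solves_IVP H v0 v ->
  {for x, continuous rho} -> (forall x', rho x' <= v0 x') -> 0 < e ->
  \forall z \near (x, 0), 0 <= z.2 -> rho x - e <= v z.
Proof.
move=> [_ _ _ hv] rhoc v0rho e0.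
have e20 : 0 < e / 2 by lra.
have : ((rho x - e)%:E <
    limf_einf (EFin \o v) (within (@upper_closed R X) (nbhs ((x, 0%R) : X * R))))%E.
  apply: lt_le_trans (hv x).
  apply: (@lt_le_trans _ _ (rho x - e / 2)%:E); first by rewrite lte_fin; lra.
  pose A := [set x' | rho x - e / 2 < rho x'].
  rewrite limf_einfE; apply: le_ereal_sup_tmp; exists (ereal_inf [set (EFin \o v0) x' | x' in A]).
    exists A => //; apply: (rhoc [set t | rho x - e / 2 < t]).
    by apply: lt_nbhsr; lra.
  apply: le_ereal_inf_tmp => _ [x' Ax' <-] /=; rewrite lee_fin.
  exact: le_trans (ltW Ax') (v0rho x').
rewrite limf_einfE; case/ereal_sup_gt => _ [B nB <-] hB.
have {}nB : \forall z \near ((x, 0) : X * R), upper_closed z -> B z := nB.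
apply: filterS nB => z Bz z0.
rewrite -lee_fin; apply: le_trans (ltW hB) _.
by apply: ereal_inf_lbound; exists z => //; exact: Bz.
Qed.

Lemma initial_layer (K : set X) (P : X * R -> Prop) : compact K ->
  (forall x, K x -> \forall z \near (x, 0), 0 <= z.2 -> P z) ->
  exists2 d : R, 0 < d & forall x s, K x -> 0 <= s -> s < d -> P (x, s).
Proof.
move=> /compact_near_coveringP cK hP.
have : \forall s \near (0 : R), K `<=` [set x | 0 <= s -> P (x, s)].
  apply: (cK R (nbhs (0 : R)) (fun s x => 0 <= s -> P (x, s))) => x /hP.
  by apply: filterS => -[x' i].
move=> /nbhs_ballP[d /= d0 hd]; exists d => // x s Kx s0 sd.
apply: (hd s) => //; rewrite -ball_normE /= sub0r normrN ger0_norm//.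
Qed.

Lemma initial_lower_uniform (g : X * R -> R) (rho : X -> R) (k : R) : 0 <= k ->
  (forall x y, `|rho x - rho y| <= k * enorm (x - y)) ->
  (forall x (e : R), 0 < e -> \forall z \near (x, 0), 0 <= z.2 -> rho x - e <= g z) ->
  forall r e : R, 0 < e -> exists2 d : R, 0 < d &
  forall x s, enorm x <= r -> 0 <= s -> s < d -> rho x - e <= g (x, s).
Proof.
move=> k0 rhok grho r e e0; have e20 : 0 < e / 2 by lra.
have [x _|d d0 hd] := @initial_layer _ (fun w : X * R => rho w.1 - e <= g w) (@ball_compact R n r).
  have near_rho : \forall z \near ((x, 0) : X * R), k * enorm (z.1 - x) < e / 2.
    pose q : R := e / 2 / (k + 1).
    have q0 : 0 < q by rewrite divr_gt0// ltr_wpDl.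
    have cont : {for ((x, 0) : X * R), continuous (fun z : X * R => dot (z.1 - x) (z.1 - x))}.
      exact: (C1_continuous (test_dist x)).
    have nb : nbhs (dot (x - x) (x - x)) [set t | t < q ^+ 2].
      by apply: lt_nbhsl; rewrite subrr dot0l exprn_gt0.
    have nb' : \forall z \near ((x, 0) : X * R), dot (z.1 - x) (z.1 - x) < q ^+ 2 by exact: cont nb.
    apply: filterS nb' => z hz.
    have : enorm (z.1 - x) < q.
      by rewrite -(@ltr_pXn2r _ 2) ?nnegrE ?enorm_ge0 ?(ltW q0)// enorm_sqr.
    have qk : q * (k + 1) = e / 2 by rewrite divfK// gt_eqF// ltr_wpDl.
    have := enorm_ge0 (z.1 - x); nra.
  apply: filterS2 near_rho (grho x _ e20) => z h1 h2 /h2 h3.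
  have := le_trans (ler_norm _) (rhok z.1 x); lra.
exists d => // x s xr s0 sd; apply: (hd (x : X) s) => //=.
exact: le_trans (norm_le_enorm _) xr.
Qed.

End InitialData.

Section Monotonicity.
Context {R : realType} {n : nat}.
Local Notation X := (euclid R n).
Variable b : X * R -> X.
Hypothesis hb : forall z, 0 <= z.2 -> enorm (b z) <= 1 / 100.

Lemma hamV_sub_le_initial f v0 rho z (t : R) :
  solves_IVP (hamV b) v0 f -> continuous rho -> (forall x, v0 x <= rho x) ->
  0 < t -> f (z, t) <= rho z.
Proof.
move=> sf rhoc v0rho t0; apply/ler_addgt0Pr => e e0.
have cz : compact [set z] by exact: compact_set1.
have [|d d0 hd] := @initial_layer _ _ _ (fun w => f w <= rho z + e) cz.
  by move=> x ->; exact: solves_IVP_le sf (rhoc z) v0rho e0.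
pose s := Num.min (d / 2) (t / 2).
have s0 : 0 < s by rewrite lt_min !divr_gt0.
have sd : s < d by rewrite gt_min ltr_pdivrMr// ltr_pMr// ltr1n.
have st : s < t by rewrite gt_min orbC ltr_pdivrMr// ltr_pMr// ltr1n.
case: sf => -[fsub _] _ _ _.
apply: le_trans (hd z s erefl (ltW s0) sd).
by have := hamV_sub_line z z hb fsub s0 st; rewrite subrr dot0l mul0r addr0.
Qed.

Lemma hamV_sub_hamG f :
  viscosity_subsolution (@upper R X) (evolution (hamV b)) f ->
  viscosity_subsolution (@upper R X) (evolution (hamG b)) f.
Proof.
move=> [fc fsub]; split=> // phi z Uz phiC loc.
apply: le_trans _ (fsub phi z Uz phiC loc); apply: lerD => //.
rewrite /hamG /hamV; set e := enorm _; set d := dot _ _.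
by have := sqr_ge0 (e - 1); lra.
Qed.

Variable L : R.
Hypothesis bL : forall z z', 0 <= z.2 -> 0 <= z'.2 -> enorm (b z' - b z) <= L * enorm_st (z - z').

Lemma dot_drift_le z z' p : 0 <= z.2 -> 0 <= z'.2 ->
  dot (b z') p <= dot (b z) p + L * enorm_st (z - z') * enorm p.
Proof.
move=> z0 z0'; rewrite -lerBlDl -dotBl (le_trans (dot_le_enorm _ _))//.
by rewrite ler_wpM2r ?enorm_ge0// bL.
Qed.

Lemma hamV_drift z z' p : 0 <= z.2 -> 0 <= z'.2 ->
  hamV b z' p <= hamV b z p + L * enorm_st (z - z') * enorm p.
Proof. by move=> z0 z0'; have := dot_drift_le p z0 z0'; rewrite /hamV; lra. Qed.

Lemma hamG_drift z z' p : 0 <= z.2 -> 0 <= z'.2 ->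
  hamG b z' p <= hamG b z p + L * enorm_st (z - z') * enorm p.
Proof. by move=> z0 z0'; have := dot_drift_le p z0 z0'; rewrite /hamG; lra. Qed.

End Monotonicity.
Section QuadraticComparison.
Context {R : realType} {n : nat}.
Local Notation X := (euclid R n).

Lemma test_quadratic (C B T : R) :
  test (fun z : X * R => C + B * dot z.1 z.1 * (1 + z.2 / T) + 2 * z.2)
       (fun z => (2 * B * (1 + z.2 / T)) *: z.1)
       (fun z => B * dot z.1 z.1 / T + 2).
Proof.
have F := testD (test_cst 1 : @test R n _ _ _) (testZ T^-1 test_time).
apply: test_ext (testD (testD (test_cst C) (testM (testZ B (test_dist (0 : X))) F))
  (testZ 2 test_time)) _ _ _ => z /=.
- by rewrite subr0 [T^-1 * _]mulrC.
- rewrite !(scaler0, addr0, add0r, subr0) !scalerA; congr (_ *: _); ring.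
- by rewrite subr0; ring.
Qed.

Variables (b : X * R -> X) (L : R).
Hypothesis hb : forall z, 0 <= z.2 -> enorm (b z) <= 1 / 100.
Hypothesis L0 : 0 <= L.
Hypothesis bL : forall z z', 0 <= z.2 -> 0 <= z'.2 -> enorm (b z' - b z) <= L * enorm_st (z - z').

Lemma hamV_convex_combination z (p D : X) (lam : R) : 0 <= z.2 -> 0 < lam -> lam < 1 ->
  hamV b z (lam *: p - (1 - lam) *: D) <= lam * hamV b z p + (1 - lam) * (dot D D + 1).
Proof.
move=> z0 lam0 lam1.
have hB : dot (b z) (b z) <= (1 / 100) ^+ 2 by rewrite -enorm_le ?hb ?divr_ge0.
have h1 : 0 <= (1 - lam) * lam * dot (p + D) (p + D).
  by rewrite !mulr_ge0 ?dot_ge0 ?subr_ge0 ?ltW.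
have h2 : 0 <= (1 - lam) * dot (b z + D) (b z + D).
  by rewrite !mulr_ge0 ?dot_ge0 ?subr_ge0 ?ltW.
have h3 : 0 <= (1 - lam) * ((1 / 100) ^+ 2 - dot (b z) (b z)).
  by rewrite mulr_ge0 ?subr_ge0// ltW.
rewrite /hamV !enorm_sqr; move: h1 h2 h3; rewrite !dotE (dotC D p) (dotC D (b z)).
lra.
Qed.

Variables (f g : X * R -> R) (rho : X -> R) (k : R).
Hypothesis k0 : 0 <= k.
Hypothesis rhok : forall x y, `|rho x - rho y| <= k * enorm (x - y).
Hypothesis rho0 : rho 0 = 0.
Hypothesis fsub : viscosity_subsolution (@upper R X) (evolution (hamV b)) f.
Hypothesis frho : forall x t, 0 < t -> f (x, t) <= rho x.
Hypothesis gsol : viscosity_solution (@upper R X) (evolution (hamV b)) g.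
Hypothesis grho : forall x (e : R), 0 < e -> \forall z \near (x, 0), 0 <= z.2 -> rho x - e <= g z.

Let rho_abs x : `|rho x| <= k * enorm x.
Proof. by have := rhok x 0; rewrite rho0 !subr0. Qed.

Lemma hamV_comparison_scaled x1 (t1 T lam : R) : 0 < t1 -> t1 < T -> 0 < lam -> lam < 1 ->
  lam * f (x1, t1) - g (x1, t1) <= (1 - lam) *
    (1 + 4 * T * k ^+ 2 + (16 * T)^-1 * dot x1 x1 * (1 + t1 / T) + 2 * t1).
Proof.
move=> t10 tT lam0 lam1.
have T0 : 0 < T by exact: lt_trans tT.
pose B : R := (16 * T)^-1.
have B0 : 0 < B by rewrite invr_gt0 mulr_gt0.
have BT : B * (16 * T) = 1 by rewrite mulVf// gt_eqF// mulr_gt0.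
pose C : R := 1 + 4 * T * k ^+ 2.
have PsiT := testZ (1 - lam) (@test_quadratic C B T).
have l10 : 0 < 1 - lam by rewrite subr_gt0.
have lB0 : 0 < (1 - lam) * B by rewrite mulr_gt0.
pose T' := T + 2 / ((1 - lam) * B).
have TT' : T < T' by rewrite ltrDl divr_gt0.
have [r r0 [hr x1r]] : exists2 r : R, 0 < r &
   k * r - g (0, T') <= (1 - lam) * B * r ^+ 2 / 2 /\ dot x1 x1 < r ^+ 2.
  have [c c0 cE] : exists2 c : R, 0 < c & c = (1 - lam) * B / 2.
    by exists ((1 - lam) * B / 2) => //; exact: divr_gt0.
  pose G := `|g (0, T')|.
  have G0 : 0 <= G by exact: normr_ge0.
  have q0 : 0 <= (k + G) / c by apply: divr_ge0; [exact: addr_ge0|exact: ltW].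
  have qc : (k + G) / c * c = k + G by rewrite divfK// gt_eqF.
  have e0 := enorm_ge0 x1.
  exists ((k + G) / c + enorm x1 + 1); first by lra.
  set q := (k + G) / c in q0 qc *.
  have Gg : - g (0, T') <= G by rewrite /G -normrN ler_norm.
  rewrite mulrAC -cE -enorm_sqr; split; last by nra.
  have : 0 <= c * (enorm x1 + 1) * (q + enorm x1 + 1).
    by rewrite !mulr_ge0 ?addr_ge0 ?(ltW c0).
  nra.
have [d d0 hd] := initial_lower_uniform k0 rhok grho r l10.
pose s := Num.min (d / 2) (t1 / 2).
have s0 : 0 < s by rewrite lt_min !divr_gt0.
have sd : s < d by rewrite gt_min ltr_pdivrMr// ltr_pMr// ltr1n.
have st : s < t1 by rewrite gt_min orbC ltr_pdivrMr// ltr_pMr// ltr1n.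
pose Qf (z : X * R) := dot (z.1 - 0) (z.1 - 0).
have Qc : continuous Qf := C1_continuous (test_dist 0).
have QE z : Qf z = dot z.1 z.1 by rewrite /Qf subr0.
have cK : compact (region Qf (r ^+ 2) s T).
  apply: (@region_compact _ _ _ _ _ _ r Qc) => z [_]; rewrite QE.
  by rewrite enorm_le// ltW.
have KU := region_upper (Qf := Qf) (r := r ^+ 2) (T := T) s0.
have zge0 z : region Qf (r ^+ 2) s T z -> 0 <= z.2 by move=> /KU /ltW.
have HL z z' p : region Qf (r ^+ 2) s T z -> region Qf (r ^+ 2) s T z' ->
    hamV b z' p <= hamV b z p + L * enorm_st (z - z') * enorm p.
  by move=> Kz Kz'; apply: (hamV_drift bL); exact: zge0.
have cmp := parabolic_doubling cK (region_interior_open (r := r ^+ 2) (s := s) Qc) KU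
  (@interior_region _ _ _ _ _ _) (@region_le _ _ _ _ _ _) fsub
  (viscosity_test_supersolution (proj2 gsol)) lam0 L0 l10 HL PsiT.
apply: (cmp _ _ (x1, t1)).
- move=> z p Oz zT.
  have Kz := interior_region Oz zT.
  apply: le_trans (hamV_convex_combination p _ (zge0 z Kz) lam0 lam1) _.
  rewrite -[leRHS]addrA lerD2l.
  have z2T : 0 <= z.2 / T by rewrite divr_ge0 ?zge0 ?ltW.
  have z2T1 : z.2 / T <= 1 by rewrite ler_pdivrMr ?mul1r ?ltW.
  have zz := dot_ge0 z.1.
  suff : dot ((2 * B * (1 + z.2 / T)) *: z.1) ((2 * B * (1 + z.2 / T)) *: z.1) <= B * dot z.1 z.1 / T.
    by nra.
  have -> : B * dot z.1 z.1 / T = (4 * B) ^+ 2 * dot z.1 z.1.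
    have -> : T^-1 = 16 * B by rewrite /B; field; exact: lt0r_neq0.
    by ring.
  rewrite dotZl dotZr mulrA -expr2 ler_wpM2r// lerXn2r ?nnegrE ?mulr_ge0 ?addr_ge0 ?(ltW B0)//.
  by nra.
- move=> z Kz nO; have [/andP[sz zT] Qz] := Kz.
  have zz0 : 0 <= B * dot z.1 z.1 by rewrite mulr_ge0 ?dot_ge0 ?ltW.
  have z2T : 0 <= z.2 / T by rewrite divr_ge0 ?zge0 ?ltW.
  have lrho : lam * f z <= lam * rho z.1.
    by rewrite ler_wpM2l ?(ltW lam0)//; case: z Kz {nO sz zT Qz zz0 z2T} => x t /KU; exact: frho.
  have [zs|Qr] := region_boundary Kz nO.
    have gz : rho z.1 - (1 - lam) <= g z.
      have -> : z = (z.1, s) by rewrite -zs -surjective_pairing.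
      by apply: hd => //; [rewrite enorm_le ?(ltW r0)// -QE|exact: ltW].
    have : - rho z.1 <= k * enorm z.1.
      by rewrite (le_trans _ (rho_abs _))// -normrN ler_norm.
    have : 0 <= B * (enorm z.1 - 8 * T * k) ^+ 2 by rewrite mulr_ge0 ?sqr_ge0 ?ltW.
    have BT' : 16 * (B * T) = 1 by have := BT; lra.
    have -> : B * (enorm z.1 - 8 * T * k) ^+ 2 =
        B * dot z.1 z.1 - 16 * (B * T) * (k * enorm z.1) + 16 * (B * T) * (4 * T * k ^+ 2).
      by rewrite -enorm_sqr; ring.
    rewrite BT' !mul1r => h1 h2.
    have h3 : 0 <= B * dot z.1 z.1 * (z.2 / T) by rewrite mulr_ge0.
    have h4 := zge0 z Kz.
    have h5 : (1 - lam) * (1 - rho z.1) <= (1 - lam) * (C + B * dot z.1 z.1 * (1 + z.2 / T) + 2 * z.2).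
      by rewrite ler_wpM2l ?ltW// /C mulrDr mulr1; lra.
    lra.
  have h1 : g (0, T') <= g z + r ^+ 2 / (T' - z.2).
    have := hamV_sub_line z.1 0 hb (proj1 gsol) (KU z Kz) (le_lt_trans zT TT').
    by rewrite -surjective_pairing sub0r dotNl dotNr opprK -QE Qr.
  have h2 : r ^+ 2 / (T' - z.2) <= (1 - lam) * B * r ^+ 2 / 2.
    have -> : (1 - lam) * B * r ^+ 2 / 2 = r ^+ 2 / (T' - T).
      rewrite /T' addrAC subrr add0r invf_div; ring.
    rewrite ler_wpM2l ?sqr_ge0// lef_pV2 ?posrE ?subr_gt0// ?lerD2l ?lerN2//.
    exact: le_lt_trans TT'.
  have h3 : lam * rho z.1 <= k * r.
    apply: le_trans (_ : `|rho z.1| <= _).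
      apply: le_trans (_ : lam * `|rho z.1| <= _).
        by apply: ler_wpM2l; [exact: ltW|exact: ler_norm].
      by apply: ler_piMl => //; exact: ltW.
    by apply: le_trans (rho_abs _) _; rewrite ler_wpM2l// enorm_le ?(ltW r0)// -QE Qr.
  have h5 : (1 - lam) * (B * r ^+ 2) <= (1 - lam) * (C + B * dot z.1 z.1 * (1 + z.2 / T) + 2 * z.2).
    have h6 : 0 <= B * r ^+ 2 * (z.2 / T) by rewrite mulr_ge0// mulr_ge0 ?sqr_ge0// ltW.
    have h7 : 0 <= C by rewrite addr_ge0// !mulr_ge0 ?sqr_ge0// ltW.
    have h8 := zge0 z Kz.
    by rewrite ler_wpM2l ?ltW// -QE Qr mulrDr mulr1; lra.
  apply: le_trans _ h5.
  lra.
- by split; rewrite /= ?QE /=; [rewrite !ltW|exact: ltW].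
- by [].
Qed.

Lemma hamV_comparison x t : 0 < t -> f (x, t) <= g (x, t).
Proof.
move=> t0; have tT : t < t + 1 by rewrite ltrDl.
set psi := 1 + 4 * (t + 1) * k ^+ 2 + (16 * (t + 1))^-1 * dot x x * (1 + t / (t + 1)) + 2 * t.
apply/ler_addgt0Pr => e e0.
pose m := `|f (x, t)| + `|psi| + 1.
have m0 : 0 < m by rewrite ltr_wpDl.
pose q := Num.min (1 / 2) (e / m).
have q0 : 0 < q by rewrite lt_min !divr_gt0.
have q1 : q < 1 by rewrite gt_min; apply/orP; left; lra.
have qm : q * m <= e by rewrite -ler_pdivlMr// ge_min lexx orbT.
have l0 : 0 < 1 - q by rewrite subr_gt0.
have l1 : 1 - q < 1 by rewrite ltrBlDr ltrDl.
have := hamV_comparison_scaled x t0 tT l0 l1; rewrite -/psi.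
have : q * (f (x, t) + psi) <= q * m.
  rewrite ler_wpM2l ?(ltW q0)// /m.
  by have := ler_norm (f (x, t)); have := ler_norm psi; lra.
lra.
Qed.


End QuadraticComparison.
Section LevelSetComparison.
Context {R : realType} {n : nat}.
Local Notation X := (euclid R n).

Lemma expR_poly_le (y : R) : - 2^-1 < y -> expR (y + - 2 * (y * y)) <= 1 + y.
Proof.
move=> y2; have d0 : 0 < 1 - (y + - 2 * (y * y)) by nra.
rewrite -(ler_pM2r d0); apply: le_trans (_ : 1 <= _); last by nra.
have := ler_wpM2l (expR_ge0 (y + - 2 * (y * y))) (expR_ge1Dx (- (y + - 2 * (y * y)))).
by rewrite -expRD subrr expR0.
Qed.

Lemma hamG_homogeneous (b : X * R -> X) z (a : R) p : 0 <= a ->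
  hamG b z (a *: p) = a * hamG b z p.
Proof. by move=> a0; rewrite /hamG dotZr enormZ ger0_norm//; ring. Qed.

(* With y = (phi - phi z) / g z, the inequality e^(K (G' - G)) >= 1 + y is
   relaxed to K (G' - G) >= y - 2 y^2, so that the test function for G is a
   polynomial in the one for g. *)
Lemma test_supersolution_exp b (G : X * R -> R) (eta K : R) : 0 < eta -> 0 < K ->
  test_supersolution (hamG b) G ->
  test_supersolution (hamG b) (fun z => eta * expR (K * G z)).
Proof.
move=> eta0 K0 [Gc Gsup]; split=> [z Uz|phi p q z Uz F loc].
  apply: cvgM; first exact: cvg_cst.
  apply: (@cvg_comp _ _ _ (fun z => K * G z) expR _ (nbhs (K * G z))); last exact: continuous_expR.
  by apply: cvgM; [exact: cvg_cst|exact: Gc].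
pose W := eta * expR (K * G z).
have W0 : 0 < W by rewrite mulr_gt0 ?expR_gt0.
have Fy : test (fun z' => W^-1 * (phi z' - phi z)) (fun z' => W^-1 *: p z') (fun z' => W^-1 * q z').
  apply: test_ext (testZ W^-1 (testD F (test_cst (- phi z)))) _ _ _ => //.
    by move=> z'; rewrite addr0.
  by move=> z'; rewrite addr0.
have Ft := testZ K^-1 (testD Fy (testZ (- 2) (testM Fy Fy))).
have yc : {for z, continuous (fun z' => W^-1 * (phi z' - phi z))} by exact: (C1_continuous Fy).
have near_y : \forall z' \near z, - 2^-1 < W^-1 * (phi z' - phi z).
  apply: (yc [set t | - 2^-1 < t]); apply: lt_nbhsr.
  by rewrite subrr mulr0 oppr_lt0 invr_gt0.
have hmin : \forall z' \near z,
    G z - K^-1 * (W^-1 * (phi z - phi z) + - 2 * (W^-1 * (phi z - phi z) * (W^-1 * (phi z - phi z))))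
    <= G z' - K^-1 * (W^-1 * (phi z' - phi z) + - 2 * (W^-1 * (phi z' - phi z) * (W^-1 * (phi z' - phi z)))).
  apply: filterS2 near_y loc => z'; set y := W^-1 * (phi z' - phi z) => y2 loc.
  rewrite subrr !(mulr0, mul0r, addr0) subr0 lerBrDl -lerBrDr ler_pdivrMl//.
  rewrite -ler_expR; apply: le_trans (expR_poly_le y2) _.
  have -> : 1 + y = (W + (phi z' - phi z)) / W by rewrite mulrDl divff ?gt_eqF// /y mulrC.
  rewrite ler_pdivrMr//.
  have -> : expR (K * (G z' - G z)) * W = eta * expR (K * G z').
    by rewrite /W mulrCA -expRD; congr (_ * expR _); ring.
  by move: loc; rewrite -/W; lra.
have := Gsup _ _ _ z Uz Ft hmin; rewrite subrr !(mulr0, mul0r, scale0r, scaler0, addr0).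
have a0 : 0 < K^-1 * W^-1 by rewrite mulr_gt0 ?invr_gt0.
by rewrite scalerA mulrA (hamG_homogeneous _ _ _ (ltW a0)) -mulrDr pmulr_rge0.
Qed.

End LevelSetComparison.
Section ConeComparison.
Context {R : realType} {n : nat}.
Local Notation X := (euclid R n).

Lemma test_cone (x0 : X) (N T r sg : R) :
  let E (z : X * R) := sg * expR (N * (2 * (z.2 - T) + (2 * r)^-1 * dot (z.1 - x0) (z.1 - x0))) in
  test E (fun z => (E z * N / r) *: (z.1 - x0)) (fun z => 2 * (E z * N)).
Proof.
move=> E.
have F := testZ sg (test_expR (testZ N (testD (testZ 2 (testD test_time (test_cst (- T))))
  (testZ (2 * r)^-1 (test_dist x0))))).
apply: test_ext F _ _ _ => // z.
  rewrite addr0 scaler0 add0r !scalerA; congr (_ *: _).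
  by rewrite /E invfM; move: (r^-1) => k; field.
by rewrite /E addr0 mulr0 addr0 mulr1; ring.
Qed.

Variables (b : X * R -> X) (L : R).
Hypothesis hb : forall z, 0 <= z.2 -> enorm (b z) <= 1 / 100.
Hypothesis L0 : 0 <= L.
Hypothesis bL : forall z z', 0 <= z.2 -> 0 <= z'.2 -> enorm (b z' - b z) <= L * enorm_st (z - z').

Lemma hamG_perturbation z (p P : X) (A : R) : 0 <= z.2 -> enorm P <= A ->
  hamG b z (p - P) <= hamG b z p + 3 / 2 * A.
Proof.
move=> z0 PA; have := enormD p (- P); rewrite enormN.
have := dot_ge_enorm (b z) P; have := hb z0; have := enorm_ge0 P.
rewrite /hamG dotBr => h1 h2 h3 h4.
have : enorm (b z) * enorm P <= 1 / 100 * enorm P by rewrite ler_wpM2r.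
lra.
Qed.

(* The speed of propagation is at most 1 + 1/100 < 2, so the data on the ball
   of radius 4 T + 2 determine the solution at x0 up to time T. *)
Lemma hamG_cone_comparison v W x0 (s t0 T : R) :
  viscosity_subsolution (@upper R X) (evolution (hamG b)) v ->
  test_supersolution (hamG b) W -> (forall z, 0 <= W z) ->
  0 < s -> s <= t0 -> t0 < T ->
  (forall x, enorm (x - x0) <= 4 * T + 2 -> v (x, s) <= W (x, s)) ->
  v (x0, t0) <= W (x0, t0).
Proof.
move=> vsub Wsup W0 s0 st tT hs.
have t00 : 0 < t0 := lt_le_trans s0 st.
have T0 : 0 < T := lt_trans t00 tT.
pose r : R := 4 * T + 2.
have r0 : 0 < r by rewrite /r; lra.
pose Qf (z : X * R) := dot (z.1 - x0) (z.1 - x0).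
have Qc : continuous Qf := C1_continuous (test_dist x0).
have cK : compact (region Qf (r ^+ 2) s T).
  apply: (@region_compact _ _ _ _ _ _ (r + enorm x0) Qc) => z [_ Qz].
  rewrite -[z.1](subrK x0); apply: le_trans (enormD _ _) _.
  by rewrite lerD2r enorm_le// ltW.
have KU := region_upper (Qf := Qf) (r := r ^+ 2) (T := T) s0.
have zge0 z : region Qf (r ^+ 2) s T z -> 0 <= z.2 by move=> /KU /ltW.
have HL z z' p : region Qf (r ^+ 2) s T z -> region Qf (r ^+ 2) s T z' ->
    hamG b z' p <= hamG b z p + L * enorm_st (z - z') * enorm p.
  by move=> Kz Kz'; apply: (hamG_drift bL); exact: zge0.
have vc z : region Qf (r ^+ 2) s T z -> {for z, continuous v}.
  by move=> Kz; exact/(proj1 vsub)/KU.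
have [sg sg0 hsg] := compact_upper_bound cK vc.
apply: (@barrier_vanishes _ _ _ sg (2 * (T - t0))) => [||N N0].
- by rewrite mulr_gt0 ?subr_gt0.
- exact: ltW.
have PsiT := @test_cone x0 N T r sg; cbv zeta in PsiT.
set E := (X in test X _ _) in PsiT.
have [c c0 cE] : exists2 c : R, 0 < c & c = sg * expR (N * (- (2 * T))) * N / 2.
  by eexists; last reflexivity; rewrite divr_gt0// mulr_gt0// mulr_gt0// expR_gt0.
have cmp := parabolic_doubling cK (region_interior_open (r := r ^+ 2) (s := s) Qc) KU
  (@interior_region _ _ _ _ _ _) (@region_le _ _ _ _ _ _) vsub Wsup ltr01 L0 c0 HL PsiT.
have main : 1 * v (x0, t0) - W (x0, t0) <= E (x0, t0); last first.
  move: main; rewrite mul1r /E /= subrr dot0l mulr0 addr0 lerBlDl.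
  by rewrite -[2 * (t0 - T)]opprK -mulrN opprB.
apply: (cmp _ _ (x0, t0)).
- move=> z p Oz zT; have Kz := interior_region Oz zT.
  have [/andP[sz _] Qz] := Kz.
  have E0 : 0 < E z by rewrite mulr_gt0// expR_gt0.
  have EN0 : 0 < E z * N by rewrite mulr_gt0.
  have hP : enorm ((E z * N / r) *: (z.1 - x0)) <= E z * N.
    rewrite enormZ ger0_norm ?divr_ge0 ?(ltW EN0) ?(ltW r0)// mulrAC ler_pdivrMr//.
    by rewrite ler_wpM2l ?(ltW EN0)// enorm_le// ltW.
  rewrite scale1r mul1r; apply: le_trans (hamG_perturbation p (zge0 z Kz) hP) _.
  have : c <= E z * N / 2.
    rewrite cE ler_wpM2r ?invr_ge0// ler_wpM2r ?(ltW N0)// ler_wpM2l ?(ltW sg0)// ler_expR ler_wpM2l ?(ltW N0)//.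
    have : 0 <= (2 * r)^-1 * dot (z.1 - x0) (z.1 - x0).
      by rewrite mulr_ge0 ?dot_ge0// invr_ge0 mulr_ge0// ltW.
    by have := zge0 z Kz; lra.
  by move=> cA; rewrite -[leRHS]addrA lerD2l; move: (E z * N) cA => A cA; lra.
- move=> z Kz nO; have [/andP[sz zT] Qz] := Kz; rewrite mul1r lerBlDl.
  have E0 : 0 < E z by rewrite mulr_gt0// expR_gt0.
  have [zs|Qr] := region_boundary Kz nO.
    rewrite ler_wpDr ?(ltW E0)//.
    have -> : z = (z.1, s) by rewrite -zs -surjective_pairing.
    by apply: hs; rewrite enorm_le// ltW.
  apply: le_trans (hsg z Kz) _; rewrite ler_wpDl//.
  rewrite /E -[leLHS]mulr1 ler_wpM2l ?(ltW sg0)// -[leLHS]expR0 ler_expR.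
  rewrite mulr_ge0 ?(ltW N0)//; rewrite /Qf in Qr; rewrite Qr.
  have -> : (2 * r)^-1 * r ^+ 2 = r / 2 by field; rewrite lt0r_neq0.
  by have := zge0 z Kz; rewrite /r; lra.
- split; first by rewrite /= st ltW.
  by rewrite /Qf /= subrr dot0l sqr_ge0.
- by [].
Qed.

End ConeComparison.
Section FrontBounds.
Context {R : realType}.
Implicit Types (g : R -> R).

Lemma front_bound_continuous g : front_bound g -> continuous g.
Proof.
move=> [glip _ _ _] y; have [B nB lip] := glip y.
have [M hM] : exists M, M.-lipschitz_B g.
  exact: (@filter_ex R (+oo) _ (fun M => M.-lipschitz_B g) lip).
have By := nbhs_singleton nB.
have M0 : 0 < `|M| + 1 by rewrite ltr_wpDl.
apply/cvgrPdist_lt => e e0.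
have q0 : 0 < e / (`|M| + 1) by rewrite divr_gt0.
have := nbhsx_ballx y _ q0; rewrite -ball_normE => nq.
apply: filterS2 nB nq => z Bz /= yz.
have := hM (y, z) (conj By Bz); rewrite /self_sub /=.
move=> /le_lt_trans; apply; apply: le_lt_trans (_ : (`|M| + 1) * `|y - z| < _).
  by rewrite ler_wpM2r// (le_trans (ler_norm M))// lerDl.
by rewrite mulrC -ltr_pdivlMr.
Qed.

Lemma front_bound_le0 g y : front_bound g -> y <= 0 -> g y <= 0.
Proof.
move=> fg; have gc := front_bound_continuous fg; case: fg => _ [gd _] g'0 g0.
rewrite le_eqVlt => /predU1P[->|y0]; first by rewrite g0.
have [x||c] := @MVT R g (derive1 g) y 0 y0.
- rewrite in_itv /= => /andP[_ x0].
  apply: DeriveDef; last by rewrite derive1E.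
  by apply: diff_derivable; apply: gd => /=; rewrite lt_eqF.
- by apply: continuous_subspaceT.
rewrite in_itv /= g0 => /andP[_ c0] h.
have : 0 < derive1 g c * (0 - y) by rewrite mulr_gt0 ?subr_gt0 ?g'0// lt_eqF.
by rewrite -h sub0r oppr_gt0 => /ltW.
Qed.

Lemma front_bound_le_expR g (B eta : R) : front_bound g -> 0 < eta ->
  exists2 K : R, 0 < K & forall y m, `|y| <= B -> (0 < y -> Num.min 1 (y ^+ 2 / 5) <= m) ->
    g y <= eta * expR (K * m).
Proof.
move=> fg eta0; have gc := front_bound_continuous fg.
have g0 : g 0 = 0 by case: fg.
have /cvgrPdist_lt/(_ _ eta0)/nbhs_ballP[y1 /= y10 hy1] := gc 0.
have [M M0 hM] := @compact_upper_bound R _ `[- B, B]%classic g (@segment_compact _ _ _) (fun z _ => gc z).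
pose m1 : R := Num.min 1 (y1 ^+ 2 / 5).
have m10 : 0 < m1 by rewrite lt_min ltr01 divr_gt0// exprn_gt0.
pose K := M / (eta * m1).
have K0 : 0 < K by rewrite divr_gt0// mulr_gt0.
exists K => // y m yB hm.
have [y0|y0] := leP y 0.
  by apply: le_trans (front_bound_le0 fg y0) _; rewrite mulr_ge0 ?expR_ge0 ?ltW.
have {}hm := hm y0.
have [yy1|y1y] := ltP y y1.
  have m0 : 0 <= m by apply: le_trans hm; rewrite le_min ler01 divr_ge0 ?sqr_ge0.
  have : `|g 0 - g y| < eta.
    by apply: hy1; rewrite -ball_normE /= sub0r normrN gtr0_norm.
  rewrite g0 sub0r normrN => /ltW/(le_trans (ler_norm _))/le_trans; apply.
  rewrite -[leLHS]mulr1 ler_wpM2l ?(ltW eta0)// -[leLHS]expR0 ler_expR.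
  by rewrite mulr_ge0// ltW.
have : m1 <= m.
  apply: le_trans hm; rewrite le_min !ge_min lexx /=; apply/orP; right.
  by rewrite ler_wpM2r// lerXn2r// nnegrE ltW.
move=> mm; apply: le_trans (hM y _) _; first by rewrite /= in_itv /= -ler_norml.
apply: le_trans (_ : eta * (1 + K * m1) <= _).
  have -> : eta * (1 + K * m1) = eta + M.
    by rewrite /K; field; rewrite ?mulf_neq0 ?lt0r_neq0.
  by rewrite lerDr ltW.
rewrite ler_wpM2l ?(ltW eta0)//; apply: le_trans (expR_ge1Dx _) _.
by rewrite ler_expR ler_wpM2l// ltW.
Qed.

End FrontBounds.

Section LevelSets.
Context {R : realType} {n : nat}.
Local Notation X := (euclid R n).
Variables (b : X * R -> X) (L : R).
Hypothesis hb : forall z, 0 <= z.2 -> enorm (b z) <= 1 / 100.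
Hypothesis L0 : 0 <= L.
Hypothesis bL : forall z z', 0 <= z.2 -> 0 <= z'.2 -> enorm (b z' - b z) <= L * enorm_st (z - z').

Lemma level_set_comparison (v G : X * R -> R) (rho : X -> R) (g : R -> R) (k : R) x0 (t0 : R) :
  viscosity_subsolution (@upper R X) (evolution (hamG b)) v ->
  (forall x t, 0 < t -> v (x, t) <= g x.2) -> front_bound g ->
  viscosity_supersolution (@upper R X) (evolution (hamG b)) G ->
  (forall x (e : R), 0 < e -> \forall z \near (x, 0), 0 <= z.2 -> rho x - e <= G z) ->
  0 <= k -> (forall x y, `|rho x - rho y| <= k * enorm (x - y)) ->
  (forall x : X, 0 < x.2 -> Num.min 1 (x.2 ^+ 2 / 5) <= rho x) ->
  0 < t0 -> G (x0, t0) <= 0 -> v (x0, t0) <= 0.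
Proof.
move=> vsub vg fg Gsup grho k0 rhok rho_pos t00 Gle0.
apply/ler_addgt0Pr => e e0; rewrite add0r.
have e20 : 0 < e / 2 by rewrite divr_gt0.
pose T := t0 + 1.
pose B := `|x0.2| + (4 * T + 2).
have [K K0 hK] := front_bound_le_expR B fg e20.
pose h : R := 1 / (2 * K).
have h0 : 0 < h by rewrite divr_gt0// mulr_gt0.
have [d d0 hd] := initial_lower_uniform k0 rhok grho (enorm x0 + (4 * T + 2)) h0.
pose s := Num.min (d / 2) t0.
have s0 : 0 < s by rewrite lt_min !divr_gt0.
have sd : s < d by rewrite gt_min ltr_pdivrMr// ltr_pMr// ltr1n.
have st : s <= t0 by rewrite ge_min lexx orbT.
have tT : t0 < T by rewrite ltrDl.
have Wsup := test_supersolution_exp e0 K0 (viscosity_test_supersolution Gsup).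
apply: le_trans (hamG_cone_comparison hb L0 bL vsub Wsup _ s0 st tT _) _.
- by move=> z; rewrite mulr_ge0 ?expR_ge0// ltW.
- move=> x xr.
  have xB : `|x.2| <= B.
    rewrite -[x.2](subrK x0.2) (le_trans (ler_normD _ _))// addrC lerD2l.
    exact: le_trans (snd_le_enorm (x - x0)) xr.
  have xr' : enorm x <= enorm x0 + (4 * T + 2).
    by rewrite -[x](subrK x0) (le_trans (enormD _ _))// addrC lerD2l.
  apply: le_trans (vg x _ s0) _; apply: le_trans (hK x.2 (rho x) xB (rho_pos x)) _.
  rewrite -mulrA ler_wpM2l ?(ltW e0)//.
  apply: le_trans (_ : expR (K * (rho x - h)) <= _); last first.
    by rewrite ler_expR ler_wpM2l ?(ltW K0)// hd// ltW.
  have -> : K * (rho x - h) = - (1 / 2) + K * rho x by rewrite /h; field; rewrite lt0r_neq0.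
  rewrite expRD ler_wpM2r ?expR_ge0//.
  by apply: le_trans _ (expR_ge1Dx _); lra.
- rewrite -[leRHS]mulr1 ler_wpM2l ?(ltW e0)// -[leRHS]expR0 ler_expR.
  by rewrite pmulr_rle0.
Qed.

End LevelSets.
Section ProfileLowerBound.
Context {R : realType} {n : nat}.
Local Notation X := (euclid R n).

Lemma lipschitz_enorm (rho : X -> R) : lipschitz rho ->
  exists2 k : R, 0 <= k & forall x y, `|rho x - rho y| <= k * enorm (x - y).
Proof.
move=> lip.
have [M hM] : exists M, M.-lipschitz rho.
  exact: (@filter_ex R (+oo) _ (fun M => M.-lipschitz rho) lip).
exists `|M| => // x y; have := hM (x, y) (conj I I); rewrite /self_sub /=.
move=> /le_trans; apply; apply: le_trans (_ : `|M| * `|x - y| <= _).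
  by rewrite ler_wpM2r// ler_norm.
by rewrite ler_wpM2l// norm_le_enorm.
Qed.

Lemma enorm_continuous : continuous (@enorm R n).
Proof.
move=> x; apply/cvgrPdist_lt => e e0.
have C := @C1_dot_affine R X n idfun x (fun _ _ _ => erefl) (fun _ => cvg_id).
have nb : \forall y \near x, dot (y - x) (y - x) < e ^+ 2.
  have := @C1_continuous _ _ _ _ C x; rewrite /= => H.
  apply: (H [set t | t < e ^+ 2]); apply: lt_nbhsl.
  by rewrite subrr dot0l exprn_gt0.
apply: filterS nb => y; rewrite -enorm_sqr ltr_pXn2r ?nnegrE ?enorm_ge0 ?ltW// => h.
have h1 := enormD (x - y) y; have h2 := enormD (y - x) x.
rewrite !subrK in h1 h2; rewrite -(enormN (y - x)) opprB in h h2.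
by rewrite ltr_norml; lra.
Qed.

Lemma lipschitz_continuous (rho : X -> R) (k : R) : 0 <= k ->
  (forall x y, `|rho x - rho y| <= k * enorm (x - y)) -> continuous rho.
Proof.
move=> k0 hk x; apply/cvgrPdist_lt => e e0.
have q0 : 0 < e / (k + 1) by rewrite divr_gt0// ltr_wpDl.
have /cvgrPdist_lt/(_ _ q0) : {for 0, continuous (@enorm R n)} by exact: enorm_continuous.
rewrite enorm0 => nb.
have : \forall y \near x, `|0 - enorm (x - y)| < e / (k + 1).
  have c : (fun y => x - y) @ x --> (0 : X).
    by rewrite -[X in _ --> X](subrr x); apply: cvgB; [exact: cvg_cst|exact: cvg_id].
  exact: c nb.
apply: filterS => y; rewrite sub0r normrN ger0_norm ?enorm_ge0// => h.
apply: le_lt_trans (hk x y) _; rewrite ltr_pdivlMr ?ltr_wpDl// in h.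
by have := enorm_ge0 (x - y); nra.
Qed.

Variables (D : X -> X) (rho : X -> R) (k : R).
Hypothesis hD : forall z, enorm (D z) <= 1 / 100.
Hypothesis k0 : 0 <= k.
Hypothesis rhok : forall x y, `|rho x - rho y| <= k * enorm (x - y).
Hypothesis rho_sup : viscosity_supersolution setT
  (fun phi z => dot (D z) (grad phi z) + enorm (grad phi z) - 1) rho.
Hypothesis rho_flat : forall x, rho (x, 0) = 0.

Let J (z0 z : X) : R := rho z + 5^-1 * dot (z - z0) (z - z0).

Lemma critical_point_far z0 z :
  (\forall z' \near z, J z0 z <= J z0 z') -> 6 / 5 <= 5^-1 * dot (z - z0) (z - z0).
Proof.
move=> loc.
have C := C1Z (- 5^-1) (@C1_dot_affine R X n idfun z0 (fun _ _ _ => erefl) (fun _ => cvg_id)).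
have gE : grad (fun z => - 5^-1 * dot (idfun z - z0) (idfun z - z0)) z = - (2 / 5) *: (z - z0).
  by apply: (grad_C1 C) => v; rewrite /= dotZl; ring.
have := proj2 rho_sup _ z I (C1_Ck C _); rewrite gE => /(_ _)/=.
have hloc : \forall z' \near z, rho z - - 5^-1 * dot (z - z0) (z - z0) <=
    rho z' - - 5^-1 * dot (z' - z0) (z' - z0).
  by apply: filterS loc => z'; rewrite /J !mulNr !opprK.
move=> /(_ hloc).
set p := - (2 / 5) *: (z - z0) => h.
have h1 := dot_le_enorm (D z) p; have h2 := enorm_ge0 p.
have h3 : enorm (D z) * enorm p <= 1 / 100 * enorm p by rewrite ler_wpM2r.
have h4 : 100 / 101 <= enorm p by lra.
have : (100 / 101) ^+ 2 <= dot p p by rewrite -enorm_ge.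
by rewrite /p dotZl dotZr; lra.
Qed.

Lemma profile_lower_step m z0 : (forall z, 0 <= z.2 -> m <= rho z) -> 0 < z0.2 ->
  Num.min (z0.2 ^+ 2 / 5) (m + 6 / 5) <= rho z0.
Proof.
move=> hm z00.
pose r : R := 5 * (rho z0 - m) + 5.
have r1 : 5 <= r by have := hm z0 (ltW z00); rewrite /r; lra.
pose K := [set z : X | 0 <= z.2 /\ dot (z - z0) (z - z0) <= r].
have dc : continuous (fun z : X => dot (z - z0) (z - z0)).
  exact: (C1_continuous (@C1_dot_affine R X n idfun z0 (fun _ _ _ => erefl) (fun _ => cvg_id))).
have Jc : continuous (J z0).
  move=> z; apply: cvgD; first exact: (lipschitz_continuous k0 rhok).
  by apply: cvgM; [exact: cvg_cst|exact: dc].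
have cK : compact K.
  apply: (@subclosed_compact _ _ _ _ (@ball_compact R n (r + enorm z0))).
    have -> : K = (snd @^-1` [set t | 0 <= t]) `&`
        ((fun z : X => dot (z - z0) (z - z0)) @^-1` [set t | t <= r]) by [].
    apply: closedI; apply: preimage_closed.
    + by move=> z _; exact: cvg_snd.
    + exact: closed_ge.
    + by move=> z _; exact: dc.
    + exact: closed_le.
  move=> z [_ Kz] /=; apply: le_trans (norm_le_enorm _) _.
  rewrite -[z in enorm z](subrK z0); apply: le_trans (enormD _ _) _.
  rewrite lerD2r enorm_le; last by lra.
  by apply: le_trans Kz _; nra.
have Kz0 : K z0 by split; [exact: ltW|rewrite subrr dot0l; lra].
have nJc z : K z -> {for z, continuous (fun z => - J z0 z)} by move=> _; apply: cvgN; exact: Jc.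
have [z Kz hz] := compact_argmax cK (ex_intro _ z0 Kz0) nJc.
have Jz z' : K z' -> J z0 z <= J z0 z' by move/hz; rewrite lerN2.
have Jz0 : J z0 z <= rho z0 by have := Jz _ Kz0; rewrite {2}/J subrr dot0l mulr0 addr0.
have mz := hm z (proj1 Kz).
have dr : dot (z - z0) (z - z0) < r.
  by move: Jz0; rewrite /J /r; lra.
have [z2|z2] := ltP 0 z.2.
  have oO : open [set z : X | 0 < z.2 /\ dot (z - z0) (z - z0) < r].
    have -> : [set z : X | 0 < z.2 /\ dot (z - z0) (z - z0) < r] =
        (snd @^-1` [set t | 0 < t]) `&`
        ((fun z : X => dot (z - z0) (z - z0)) @^-1` [set t | t < r]) by [].
    by apply: openI; apply: open_comp; [move=> ? _; exact: cvg_snd|exact: open_gt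
      |move=> ? _; exact: dc|exact: open_lt].
  have := @critical_point_far z0 z; rewrite ge_min => H; apply/orP; right.
  suff : 6 / 5 <= 5^-1 * dot (z - z0) (z - z0) by move: Jz0; rewrite /J; lra.
  apply: H; apply: filterS (open_nbhs_nbhs (conj oO (conj z2 dr))) => z' [h1 h2].
  by apply: Jz; split; apply: ltW.
have {}z2 : z.2 = 0 by apply/le_anti; rewrite z2 (proj1 Kz).
rewrite ge_min; apply/orP; left.
have rz : rho z = 0 by rewrite (surjective_pairing z) z2 rho_flat.
have : z0.2 ^+ 2 <= dot (z - z0) (z - z0).
  have := snd_le_enorm (z - z0); rewrite -enorm_sqr /= z2 sub0r normrN (gtr0_norm z00) => h.
  by rewrite lerXn2r// nnegrE ?enorm_ge0// ltW.
by move: Jz0; rewrite /J rz; lra.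
Qed.

Lemma profile_ge0 (N : nat) : (forall z, 0 <= z.2 -> - N%:R <= rho z) ->
  forall z, 0 <= z.2 -> 0 <= rho z.
Proof.
elim: N => [|N IHN] hN; first by move=> z /hN; rewrite oppr0.
apply: IHN => z; rewrite le_eqVlt => /predU1P[z0|z0].
  by rewrite (surjective_pairing z) -z0 rho_flat oppr_le0.
apply: le_trans (profile_lower_step hN z0).
rewrite le_min; have -> : N.+1%:R = N%:R + 1 :> R by rewrite -natr1.
have N0 : 0 <= N%:R :> R by [].
apply/andP; split; last by lra.
by apply: le_trans (_ : 0 <= _); rewrite ?oppr_le0// divr_ge0 ?sqr_ge0.
Qed.

Hypothesis rho_liminf : forall e : R, 0 < e -> \forall y \near +oo, forall x, - e <= rho (x, y).

Lemma profile_lower_bound z : 0 < z.2 -> Num.min 1 (z.2 ^+ 2 / 5) <= rho z.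
Proof.
move=> z0; have [Y [_ hY]] := rho_liminf ltr01.
have [N hN] : exists N : nat, forall z, 0 <= z.2 -> - N%:R <= rho z.
  have c0 : 0 <= 1 + k * (`|Y| + 1) by rewrite addr_ge0// mulr_ge0// addr_ge0.
  exists (Num.truncn (1 + k * (`|Y| + 1))).+1 => x x0.
  have := truncnS_gt (1 + k * (`|Y| + 1)); set N := _%:R => hN.
  have [xY|Yx] := ltP Y x.2.
    have := hY _ xY x.1; rewrite -surjective_pairing.
    have : 0 <= k * (`|Y| + 1) by rewrite mulr_ge0// addr_ge0.
    lra.
  have xx : enorm (x - (x.1, 0)) <= x.2.
    rewrite enorm_le// /dot /= subr0 big1 ?add0r// => i _.
    by rewrite !mxE subrr mul0r.
  have := rhok x (x.1, 0); rewrite rho_flat subr0 => /(le_trans _).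
  move=> /(_ (- rho x)); rewrite -[`|rho x|]normrN ler_norm => /(_ isT) h.
  have : k * enorm (x - (x.1, 0)) <= k * (`|Y| + 1).
    by rewrite ler_wpM2l//; have := ler_norm Y; lra.
  lra.
have := profile_lower_step (profile_ge0 hN) z0; apply: le_trans.
by rewrite le_min !ge_min lexx orbT /=; apply/orP; left; lra.
Qed.

End ProfileLowerBound.
Section AdvectionBounds.
Context {R : realType} {n : nat}.
Local Notation X := (euclid R n).

Lemma linear_continuous_differentiable (V W : normedModType R) (l : V -> W) z :
  linear l -> continuous l -> differentiable l z.
Proof.
move=> ll lc; pose lM := GRing.isLinear.Build _ _ _ _ _ ll.
pose l' : {linear V -> W} := HB.pack l lM.
exact: (@linear_differentiable _ _ _ l' z lc).
Qed.

Lemma C1norm_bounds (u : X * R -> X) (eps : R) : 0 < eps ->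
  (eps%:E * C1norm (@enorm_st R n) (@enorm R n) (@upper R X) u <= (1 / 100%:R)%:E)%E ->
  (forall z, upper z -> eps * enorm (u z) <= 1 / 100) /\
  (forall z v, upper z -> enorm_st v = 1 -> eps * enorm ('D_v u z) <= 1 / 100).
Proof.
move=> eps0 h; split=> [z Uz|z v Uz v1]; rewrite -lee_fin EFinM; apply: le_trans h;
  rewrite lee_pmul2l ?lte_fin//; rewrite /C1norm le_max; apply/orP.
- by left; apply: ereal_sup_ubound; exists z.
- by right; apply: ereal_sup_ubound; exists (z, v).
Qed.

Lemma enorm_stZ (c : R) (v : X * R) : enorm_st (c *: v) = `|c| * enorm_st v.
Proof.
rewrite /enorm_st /= dotZl dotZr.
have -> : c * (c * dot v.1 v.1) + (c *: v.2) ^+ 2 = c ^+ 2 * (dot v.1 v.1 + v.2 ^+ 2).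
  by rewrite /GRing.scale /=; ring.
by rewrite sqrtrM ?sqr_ge0// sqrtr_sqr.
Qed.

Lemma derive_norm_bound (u : X * R -> X) (c : R) z v :
  (forall v, enorm_st v = 1 -> enorm ('D_v u z) <= c) -> differentiable u z ->
  enorm ('D_v u z) <= c * enorm_st v.
Proof.
move=> h du; have [v0|v0] := eqVneq (enorm_st v) 0.
  have vE : v = 0.
    by apply/eqP; rewrite -normr_le0; have := norm_le_enorm_st v; rewrite v0.
  by rewrite v0 mulr0 vE deriveE// linear0 enorm0.
have v1 : 0 < enorm_st v by rewrite lt0r v0 enorm_st_ge0.
have := h ((enorm_st v)^-1 *: v); rewrite !deriveE// linearZ enormZ enorm_stZ.
rewrite ger0_norm ?invr_ge0 ?enorm_st_ge0// mulVf// => /(_ erefl).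
by rewrite ler_pdivrMl// mulrC.
Qed.

Lemma is_diff_dot (q w : X) : is_diff w (fun w => dot w q) (fun w => dot w q).
Proof.
have C (c : X) := @C1_dot_affine R X n idfun c (fun _ _ _ => erefl) (fun _ => cvg_id).
have dc : continuous (fun w : X => dot w q).
  have -> : (fun w : X => dot w q) =
      (fun w => 4^-1 * (dot (idfun w - - q) (idfun w - - q) + - 1 * dot (idfun w - q) (idfun w - q))).
    by apply/funext => x /=; rewrite opprK !dotE (dotC q x); field.
  exact: (C1_continuous (C1Z 4^-1 (C1D (C (- q)) (C1Z (- 1) (C q))))).
have [|d _] := @C1_linear R X (fun w => dot w q) _ dc; last exact: d.
by move=> a x y; rewrite dotDl dotZl.
Qed.

Lemma lipschitz_of_derive (u : X * R -> X) (c : R) : 0 <= c ->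
  (forall z, upper z -> differentiable u z) ->
  (forall z v, upper z -> enorm ('D_v u z) <= c * enorm_st v) ->
  forall z z', upper z -> upper z' -> enorm (u z' - u z) <= c * enorm_st (z' - z).
Proof.
move=> c0 du hD z z' Uz Uz'.
pose q : X := u z' - u z; pose v : X * R := z' - z.
pose line (s : R) : X * R := z + s *: v.
pose phi (s : R) : R := dot (u (line s)) q.
have Ul (s : R) : 0 <= s <= 1 -> upper (line s).
  move=> /andP[s0 s1]; rewrite /upper /line /v /=.
  have -> : z.2 + s *: (z'.2 - z.2) = (1 - s) * z.2 + s * z'.2 by rewrite /GRing.scale/=; ring.
  have [->|sn0] := eqVneq s 0; first by rewrite subr0 mul1r mul0r addr0.
  rewrite ltr_wpDl// ?mulr_ge0 ?subr_ge0//; first exact: ltW.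
  by rewrite mulr_gt0// lt0r sn0.
have dphi (s : R) : 0 <= s <= 1 -> is_derive s 1 phi (dot ('D_v u (line s)) q).
  move=> /Ul /du dus.
  have dl : is_diff s line ( *:%R^~ v).
    have d1 : is_diff s (cst z) (0 : R -> X * R) by exact: is_diff_cst.
    have d2 : is_diff s ( *:%R^~ v) ( *:%R^~ v) by exact: is_diff_scalel.
    have d3 := is_diffD d1 d2.
    by apply: is_diff_eq d3 _; rewrite add0r.
  have dul : is_diff (line s) u ('d u (line s)) by exact: differentiableP.
  have d2 : is_diff s (u \o line) ('d u (line s) \o *:%R^~ v) by exact: is_diff_comp.
  have dd := is_diff_dot q (u (line s)).
  have d3 : is_diff s ((fun w => dot w q) \o (u \o line))
    ((fun w => dot w q) \o ('d u (line s) \o *:%R^~ v)) by exact: is_diff_comp.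
  have [dp dv] : differentiable phi s /\
      'd phi s = (fun w => dot w q) \o ('d u (line s) \o *:%R^~ v) :> (R -> R) by case: d3.
  apply: DeriveDef; first exact: diff_derivable.
  by rewrite deriveE// dv /= scale1r deriveE.
have [||s] := @MVT R phi (fun s => dot ('D_v u (line s)) q) 0 1 ltr01.
- move=> s; rewrite in_itv /= => /andP[s0 s1]; apply: dphi.
  by rewrite !ltW.
- apply: continuous_in_subspaceT => s; rewrite inE /= in_itv /= => /dphi ds.
  by apply: differentiable_continuous; apply/derivable1_diffP; exact: ex_derive.
rewrite in_itv /= => /andP[s0 s1].
rewrite /phi /line scale1r scale0r addr0 /v addrCA subrr addr0 subr0 mulr1 -dotBl -/q -enorm_sqr => h.
have Us : upper (z + s *: (z' - z)) by apply: Ul; rewrite !ltW.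
have h1 := dot_le_enorm ('D_(z' - z) u (z + s *: (z' - z))) q; rewrite -h in h1.
have h2 := hD _ (z' - z) Us.
have [->|q0] := eqVneq (enorm q) 0; first by rewrite mulr_ge0 ?enorm_st_ge0.
have {}q0 : 0 < enorm q by rewrite lt0r q0 enorm_ge0.
apply: le_trans h2.
by rewrite -(ler_pM2r q0) -expr2.
Qed.

Lemma continuous_up_to_0 (V W : normedModType R) (f : V * R -> W) z :
  {within (@upper_closed R V), continuous f} -> 0 <= z.2 ->
  f (z.1, z.2 + h) @[h --> 0^'+] --> f z.
Proof.
move=> /subspace_continuousP fc z0; have fz := fc z z0.
apply: (@cvg_comp _ _ _ (fun h : R => (z.1, z.2 + h)) f _ (within (@upper_closed R V) (nbhs z))); last exact: fz.
have hc : (fun h : R => (z.1, z.2 + h)) @ 0^'+ --> z.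
  have c1 : (fun _ : R => z.1) @ 0^'+ --> z.1 by exact: cvg_cst.
  have c2 : (fun h : R => z.2 + h) @ 0^'+ --> z.2.
    rewrite -[X in _ --> X]addr0; apply: cvgD; first exact: cvg_cst.
    exact: cvg_at_right_filter cvg_id.
  by case: z c1 c2 {z0 fz} => z1 z2 c1 c2; exact: cvg_pair c1 c2.
move=> B hB.
have hB' : \forall h \near (0 : R)^'+, upper_closed (z.1, z.2 + h) -> B (z.1, z.2 + h) by exact: hc hB.
have pos : \forall h \near (0 : R)^'+, 0 < h by exact: nbhs_right_gt.
by apply: filterS2 hB' pos => h H h0; apply: H; exact: addr_ge0 z0 (ltW h0).
Qed.

Lemma closed_enorm_le (c : R) : closed [set p : X | enorm p <= c].
Proof.
apply: (@preimage_closed _ _ (@enorm R n) [set t : R | t <= c]); last exact: closed_le.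
by move=> p _; exact: enorm_continuous.
Qed.

Lemma limit_enorm_le (f : R -> X) (p : X) (c : R) : f h @[h --> 0^'+] --> p ->
  (forall h, 0 < h -> enorm (f h) <= c) -> enorm p <= c.
Proof.
move=> fp fc; apply: (@closed_cvg _ _ _ _ f _ (@closed_enorm_le c) _ p fp).
by apply: filterS (nbhs_right_gt (0 : R)) => h /fc.
Qed.

Section Advection.
Variables (uperp : X * R -> 'rV[R]_n.-1) (upar : 'rV[R]_n.-1 * R -> R) (w : R -> R).
Hypothesis huperp : C2_bounded_upto0 uperp.
Hypothesis hupar : C2_bounded_upto0 upar.
Hypothesis hw : Ck 1%N setT w.
Let u := advection uperp upar w.

Let cts : continuous (fun z : X * R => (z.1.1, z.2)).
Proof.
move=> z; have c1 : (fun z' : X * R => z'.1.1) @ z --> z.1.1.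
  by apply: (@cvg_comp _ _ _ fst fst _ (nbhs z.1)); exact: cvg_fst.
have c2 : (fun z' : X * R => z'.2) @ z --> z.2 by exact: cvg_snd.
exact: cvg_pair c1 c2.
Qed.

Lemma advection_differentiable z : upper z -> differentiable u z.
Proof.
move=> Uz; case: huperp => -[dperp _] _ _; case: hupar => -[dpar _] _ _; case: hw => dw _.
have d1 : differentiable uperp z by exact: dperp.
have d2 : differentiable upar (z.1.1, z.2) by exact: dpar.
have d3 : differentiable w z.1.2 by exact: dw.
apply: differentiable_pair => //.
apply: differentiableM.
  apply: (@differentiable_comp _ _ _ _ (fun z : X * R => (z.1.1, z.2)) upar) => //.
  by apply: linear_continuous_differentiable => // z'; exact: cts.
apply: (@differentiable_comp _ _ _ _ (fun z : X * R => z.1.2) w) => //.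
apply: linear_continuous_differentiable => // z'.
by apply: (@cvg_comp _ _ _ fst snd _ (nbhs z'.1)); [exact: cvg_fst|exact: cvg_snd].
Qed.

Lemma advection_up_to_0 z : 0 <= z.2 -> u (z.1, z.2 + h) @[h --> 0^'+] --> u z.
Proof.
move=> z0.
have c1 : uperp (z.1, z.2 + h) @[h --> 0^'+] --> uperp z.
  by apply: continuous_up_to_0 => //; case: huperp.
have c2 : upar (z.1.1, z.2 + h) * w z.1.2 @[h --> 0^'+] --> upar (z.1.1, z.2) * w z.1.2.
  apply: cvgM; last exact: cvg_cst.
  by apply: (@continuous_up_to_0 _ _ upar (z.1.1, z.2)) => //; case: hupar.
exact: cvg_pair c1 c2.
Qed.

Variable eps : R.
Hypothesis eps0 : 0 < eps.
Hypothesis small : (eps%:E * C1norm (@enorm_st R n) (@enorm R n) (@upper R X) u <= (1 / 100%:R)%:E)%E.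

Lemma advection_small z : 0 <= z.2 -> enorm (eps *: u z) <= 1 / 100.
Proof.
move=> z0; have [h _] := C1norm_bounds eps0 small.
rewrite enormZ gtr0_norm// -ler_pdivlMl//.
apply: limit_enorm_le (advection_up_to_0 z0) _ => t t0.
by rewrite ler_pdivlMl// h//; apply: lt_le_trans t0 _; rewrite lerDr.
Qed.

Lemma advection_lipschitz z z' : 0 <= z.2 -> 0 <= z'.2 ->
  enorm (eps *: u z' - eps *: u z) <= 1 / 100 * enorm_st (z - z').
Proof.
move=> z0 z0'; have [_ h] := C1norm_bounds eps0 small.
have e0 : 0 <= eps^-1 * (1 / 100) by rewrite mulr_ge0// invr_ge0 ltW.
rewrite -scalerBr enormZ gtr0_norm// -ler_pdivlMl// mulrA.
apply: limit_enorm_le (cvgB (advection_up_to_0 z0') (advection_up_to_0 z0)) _ => t t0.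
have Ut (y : X * R) : 0 <= y.2 -> upper (y.1, y.2 + t).
  by move=> y0; apply: lt_le_trans t0 _; rewrite lerDr.
have H y : upper y -> forall v, enorm ('D_v u y) <= eps^-1 * (1 / 100) * enorm_st v.
  move=> Uy v; apply: derive_norm_bound; last exact: advection_differentiable.
  by move=> v' v1; rewrite ler_pdivlMl// h.
apply: le_trans (lipschitz_of_derive e0 advection_differentiable _ (Ut z z0) (Ut z' z0')) _.
  by move=> y v Uy; exact: H.
have -> : (z'.1, z'.2 + t) - (z.1, z.2 + t) = - 1 *: (z - z').
  apply: injective_projections; rewrite /= scaleN1r opprB//.
  by rewrite opprD addrACA subrr addr0.
by rewrite enorm_stZ normrN1 [1 * enorm_st _]mul1r.
Qed.

End Advection.

Lemma enorm_st_rescale (k : R) (z : X * R) : 0 <= k ->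
  enorm_st (z.1, k * z.2) <= (1 + k) * enorm_st z.
Proof.
move=> k0; rewrite -(@ler_pXn2r _ 2) ?nnegrE ?mulr_ge0 ?addr_ge0 ?enorm_st_ge0//.
rewrite exprMn !enorm_st_sqr /= exprMn.
have := dot_ge0 z.1; have := sqr_ge0 z.2.
nra.
Qed.

Lemma eps_power_ge0 (eps : R) alpha : 0 <= eps_power eps alpha.
Proof. by case: alpha => [a||] //=; exact: powR_ge0. Qed.

Lemma H_G_hamG eps alpha (u : X * R -> X) :
  H_G eps alpha u = hamG (fun z => eps *: u (z.1, eps_power eps alpha * z.2)).
Proof. by apply/funext => z; apply/funext => p; rewrite /H_G /hamG dotZl. Qed.

Lemma H_v_hamV eps alpha (u : X * R -> X) :
  H_v eps alpha u = hamV (fun z => eps *: u (z.1, eps_power eps alpha * z.2)).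
Proof. by apply/funext => z; apply/funext => p; rewrite /H_v /hamV dotZl. Qed.

End AdvectionBounds.
Lemma ptw_inclusions (R : realType) (n : nat) (uperp : euclid R n * R -> 'rV[R]_n.-1)
  (upar : 'rV[R]_n.-1 * R -> R) (w : R -> R) (eps : R) (alpha : \bar R)
  (v0 : euclid R n -> R) (G vp v : euclid R n * R -> R) :
  C2_bounded_upto0 uperp -> C2_bounded_upto0 upar -> Ck 1%N setT w -> 0 < eps ->
  (eps%:E * C1norm (@enorm_st R n) (@enorm R n) (@upper R (euclid R n)) (advection uperp upar w)
     <= (1 / 100%:R)%:E)%E ->
  front_like v0 -> is_G_ptw eps alpha (advection uperp upar w) G ->
  is_v_ptw eps alpha (advection uperp upar w) vp ->
  (forall z, vp (z, 0) <= v0 z) -> solves_IVP (H_v eps alpha (advection uperp upar w)) v0 v ->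
  forall t : R, 0 < t ->
    [set z | G (z, t) <= 0] `<=` [set z | v (z, t) <= 0] /\
    [set z | v (z, t) <= 0] `<=` [set z | vp (z, t) <= 0].
Proof.
move=> huperp hupar hw eps0 small [_ [gl [g [_ fg v0g]]]] [rho1 prof1 hG] [rho2 prof2 hvp] hle hv t t0.
move: hG hvp hv; rewrite H_G_hamG H_v_hamV; set u := advection uperp upar w.
set b := (X in hamG X) => hG hvp hv.
pose tau := eps_power eps alpha.
have tau0 : 0 <= tau := eps_power_ge0 eps alpha.
have hb z : 0 <= z.2 -> enorm (b z) <= 1 / 100.
  by move=> z0; apply: advection_small => //; rewrite mulr_ge0.
have L0 : 0 <= 1 / 100 * (1 + tau) by rewrite mulr_ge0 ?divr_ge0 ?addr_ge0.
have bL z z' : 0 <= z.2 -> 0 <= z'.2 -> enorm (b z' - b z) <= 1 / 100 * (1 + tau) * enorm_st (z - z').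
  move=> z0 z0'.
  apply: le_trans (advection_lipschitz huperp hupar hw eps0 small _ _) _; rewrite /= ?mulr_ge0//.
  have -> : (z.1, tau * z.2) - (z'.1, tau * z'.2) = ((z - z').1, tau * (z - z').2).
    by apply: injective_projections; rewrite /= ?mulrBr.
  by rewrite -[leRHS]mulrA ler_wpM2l ?divr_ge0// enorm_st_rescale.
have [[vsub _] _ _ _] := hv.
have vV : viscosity_solution (@upper R (euclid R n)) (evolution (hamV b)) v by case: hv.
split=> z /= h.
  have [lip1 [_ sup1] flat1 inf1 _] := prof1.
  have [k k0 rhok] := lipschitz_enorm lip1.
  have gc : continuous (fun z : euclid R n => g z.2).
    move=> x; apply: (@cvg_comp _ _ _ snd g _ (nbhs x.2)); first exact: cvg_snd.
    exact: front_bound_continuous fg _.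
  have [[_ Gsup] _ _ _] := hG.
  apply: (level_set_comparison hb L0 bL (hamV_sub_hamG vsub) _ fg Gsup _ k0 rhok _ t0 h).
  - move=> x s s0.
    have v0g' y : v0 y <= g y.2 by case/andP: (v0g y).
    exact: (@hamV_sub_le_initial _ _ _ hb _ _ (fun z => g z.2) x s hv gc v0g' s0).
  - by move=> x e e0; apply: (solves_IVP_ge hG) => //; exact: (lipschitz_continuous k0 rhok).
  - move=> x; apply: (@profile_lower_bound _ _ (fun z => eps *: u (z, 0)) _ k) => //.
      by move=> y; apply: advection_small.
    move: sup1; set A := (X in viscosity_supersolution _ X) => sup1.
    suff -> : (fun phi z => dot (eps *: u (z, 0)) (grad phi z) + enorm (grad phi z) - 1) = A by [].
    by apply/funext => phi; apply/funext => y; rewrite /A mul1r dotZl expr1.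
apply: le_trans h.
have [lip2 _ flat2 _ _] := prof2.
have [k k0 rhok] := lipschitz_enorm lip2.
have rc := lipschitz_continuous k0 rhok.
have [[vpsub _] vp0 _ _] := hvp.
apply: (hamV_comparison hb L0 bL k0 rhok _ vpsub _ vV) => //.
- exact: flat2 0.
- by move=> x s s0; exact: (@hamV_sub_le_initial _ _ _ hb _ _ rho2 x s hvp rc (fun y => lexx _) s0).
- move=> x e e0; apply: (solves_IVP_ge hv) => //; first exact: rc.
  by move=> y; rewrite -vp0.
Qed.

Theorem proposition2p6 (R : realType) (d : measure_display)
  (Omega : measurableType d) (P : probability Omega R)
  (n : nat) (hn : (2 <= n)%N)
  (w : R -> {RV P >-> R}) (hw : mild_white_noise w)
  (uperp : Omega -> euclid R n * R -> 'rV[R]_n.-1)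
  (upar : Omega -> 'rV[R]_n.-1 * R -> R)
  (huperp : {ae P, forall o, C2_bounded_upto0 (uperp o)})
  (hupar : {ae P, forall o, C2_bounded_upto0 (upar o)})
  (u : Omega -> euclid R n * R -> euclid R n)
  (hu : forall o, u o = advection (uperp o) (upar o) (fun y => w y o))
  (eps : R) (heps : 0 < eps)
  (hsmall : {ae P, forall o,
     (eps%:E * C1norm (@enorm_st R n) (@enorm R n) (@upper R (euclid R n)) (u o)
        <= (1 / 100%:R)%:E)%E})
  (alpha : \bar R) (halpha : (1 <= alpha)%E)
  (v0 : Omega -> euclid R n -> R)
  (hv0 : {ae P, forall o, front_like (v0 o)})
  (Gptw vptw v : Omega -> euclid R n * R -> R)
  (hGptw : {ae P, forall o, is_G_ptw eps alpha (u o) (Gptw o)})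
  (hvptw : {ae P, forall o, is_v_ptw eps alpha (u o) (vptw o)})
  (hle : {ae P, forall o, forall z, vptw o (z, 0) <= v0 o z})
  (hv : {ae P, forall o, solves_IVP (H_v eps alpha (u o)) (v0 o) (v o)}) :
  {ae P, forall o, forall t : R, 0 < t ->
     [set z | Gptw o (z, t) <= 0] `<=` [set z | v o (z, t) <= 0] /\
     [set z | v o (z, t) <= 0] `<=` [set z | vptw o (z, t) <= 0]}.
Proof.
have [[M _ hwC1] _ _ _ _] := hw.
near=> o => t t0.
have h1 : C2_bounded_upto0 (uperp o) by near: o.
have h2 : C2_bounded_upto0 (upar o) by near: o.
have [h3 _] : Ck 1%N setT (fun y : R => w y o) /\
    (C1norm Num.norm Num.norm setT (fun y : R => w y o : R) <= M%:E)%E by near: o.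
have h4 : (eps%:E * C1norm (@enorm_st R n) (@enorm R n) (@upper R (euclid R n)) (u o)
    <= (1 / 100%:R)%:E)%E by near: o.
have h5 : front_like (v0 o) by near: o.
have h6 : is_G_ptw eps alpha (u o) (Gptw o) by near: o.
have h7 : is_v_ptw eps alpha (u o) (vptw o) by near: o.
have h8 : forall z, vptw o (z, 0) <= v0 o z by near: o.
have h9 : solves_IVP (H_v eps alpha (u o)) (v0 o) (v o) by near: o.
rewrite hu in h4 h6 h7 h9.
exact: (ptw_inclusions h1 h2 h3 heps h4 h5 h6 h7 h8 h9 t0).
Unshelve. all: by end_near.
Qed.
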